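(* Suppose there exists a strong Markovian coupling of the environment with expectation $\widehat{\mathbb{E}}^E$ satisfying $$\int_0^\infty t^d \sup_{\eta,\xi\in\Omega}\widehat{\mathbb{E}}^E_{\eta,\xi}\,\rho(\eta^1_t(0),\eta^2_t(0))\,dt<\infty .$$ Let $\alpha_\epsilon:\Omega\times\mathbb{Z}^d\to[0,\infty)$, $\epsilon\ge0$, be admissible jump rates such that $\epsilon\mapsto\alpha_\epsilon(\eta,z)$ is differentiable at $0$, $\alpha_0(\eta,z)=\alpha_0(z)$ does not depend on $\eta$, and $|||\alpha_\epsilon-\alpha_0|||_1\le C\epsilon$ for some constant $C>0$. Let $v_\epsilon$ be the asymptotic speed of the walker with rates $\alpha_\epsilon$, and let $\mu^E$ be the ergodic measure of the environment. Then $$\left|v_\epsilon-\int\sum_{z\in\mathbb{Z}^d}z\,\alpha_\epsilon(\eta,z)\,\mu^E(d\eta)\right|\le C'\epsilon^2\qquad\text{for all }\epsilon\ge0,$$ where $C'$ is a constant independent of $\alpha_\epsilon$, $\epsilon\geq 0$ (apart from its dependence on $C$).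
   Context: Setting. $(E,\rho)$ is a compact Polish space with metric $\rho\le 1$, $d\ge1$, $\Omega=E^{\mathbb{Z}^d}$ (product topology). Shifts: $\theta_x\eta(y)=\eta(y-x)$. The environment $(\eta_t)_{t\ge0}$ is a Feller process on $\Omega$ with path measures $\mathbb{P}^E_\eta$, generator $L^E$ and semigroup $S^E_t$ on $\mathcal{C}(\Omega;\mathbb{R})$; it is translation invariant: $\mathbb{P}^E_\eta(\theta_x\eta_t\in\cdot)=\mathbb{P}^E_{\theta_x\eta}(\eta_t\in\cdot)$. For $x\in\mathbb{Z}^d$, $(\Omega\times\Omega)_x=\{(\eta,\xi)\in\Omega^2:\eta(x)\ne\xi(x),\ \eta(y)=\xi(y)\ \forall y\ne x\}$. For $f:\Omega\to\mathbb{R}$, $\delta_f(x)=\sup_{(\eta,\xi)\in(\Omega\times\Omega)_x}\frac{f(\eta)-f(\xi)}{\rho(\eta(x),\xi(x))}$ and $|||f|||=\sum_{x\in\mathbb{Z}^d}\delta_f(x)$. Walker: jump rates $\alpha:\Omega\times\mathbb{Z}^d\to[0,\infty)$, continuous in the first argument; the walker $X_t$ on $\mathbb{Z}^d$ jumps from $x$ to $x+z$ at rate $\alpha(\theta_{-x}\eta_t,z)$. Rates are admissible if $\|\alpha\|_1:=\sum_z\|z\|\sup_\eta|\alpha(\eta,z)|<\infty$ and $|||\alpha|||:=\sum_z|||\alpha(\cdot,z)|||<\infty$. For a function $\beta:\Omega\times\mathbb{Z}^d\to\mathbb{R}$, $|||\beta|||_1:=\sum_z\|z\|\,|||\beta(\cdot,z)|||$.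 The environment process $\theta_{-X_t}\eta_t$ is the Markov process on $\Omega$ with generator $L^{EP}f(\eta)=L^Ef(\eta)+\sum_z\alpha(\eta,z)[f(\theta_{-z}\eta)-f(\eta)]$; under the coupling hypothesis of the claim it has a unique ergodic (stationary) probability measure $\mu^{EP}$, the environment has a unique ergodic measure $\mu^E$, and the walker has the asymptotic speed $\lim_{T\to\infty}X_T/T=\int\sum_z z\,\alpha(\eta,z)\,\mu^{EP}(d\eta)$ (a.s.). A strong Markovian coupling of the environment is a family of laws $\widehat{\mathbb{P}}^E_{\eta,\xi}$ (expectation $\widehat{\mathbb{E}}^E_{\eta,\xi}$) making $(\eta^1_t,\eta^2_t)_{t\ge0}$ a strong Markov process on $\Omega\times\Omega$ started from $(\eta,\xi)$ whose marginals have laws $\mathbb{P}^E_\eta$ and $\mathbb{P}^E_\xi$.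
   Formalization: The strong Markovian coupling is additionally required to be translation invariant; without this, decay at site 0 alone does not give a unique ergodic measure of the environment, and the claim fails. *)

(* Defs.v *)
From HB Require Import structures.
From mathcomp Require Import all_boot all_order all_algebra.
From mathcomp Require Import all_classical all_reals all_analysis.
From mathcomp Require Import measurable_realfun.

Set Implicit Arguments.
Unset Strict Implicit.
Unset Printing Implicit Defensive.

Import Order.TTheory GRing.Theory Num.Theory.
Import numFieldNormedType.Exports.

Local Open Scope classical_set_scope.
Local Open Scope ring_scope.

(** [g_sigma_algebraType] needs a pointed type. *)
#[short(type="pmetricType")]
HB.structure Definition PMetric (K : numDomainType) :=
  {M of Pointed M & Metric K M}.

(** [prod] and [prod_topology] lack the join of [Pointed] and [Topological]. *)
HB.saturate prod.

HB.instance Definition _ (I : Type) (T : I -> ptopologicalType) :=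
  Pointed.copy (prod_topology T) (forall i, T i).

Notation borel T := (g_sigma_algebraType (@open T)).

(** * Markov processes with compact state space

  A process with state space [T] is given by a sample space [W], the coordinate
  maps [Y : R -> W -> T], of which only the times [t >= 0] matter, and the
  family [P] of its laws, [P x] being the law of the process started from [x]. *)

Section Process.
Context {R : realType} {T : ptopologicalType}.
Context {dW : measure_display} {W : measurableType dW}.
Implicit Types (P : T -> probability W R) (Y : R -> W -> T).

Definition cadlag (f : R -> T) : Prop :=
  (forall t : R, 0 <= t -> f u @[u --> t^'+] --> f t) /\
  (forall t : R, 0 < t -> cvg (f u @[u --> t^'-])).

Record cadlag_process Y : Prop := {
  process_measurable :
    forall t : R, 0 <= t -> measurable_fun setT (Y t : W -> borel T) ;
  process_cadlag : forall w, cadlag (Y ^~ w) }.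

Definition natural_filtration Y (t : R) : set (set W) :=
  <<s [set A | exists (s : R) (B : set (borel T)),
        [/\ 0 <= s <= t, measurable B & A = Y s @^-1` B]] >>.

(** The sigma-algebra on paths generated by the evaluations at times [t >= 0]. *)
Definition path_event : set (set (R -> T)) :=
  <<s [set A | exists (t : R) (B : set (borel T)),
        [/\ 0 <= t, measurable B & A = [set y | B (y t)]]] >>.

Definition semigroup P Y (t : R) (f : T -> R) (x : T) : R :=
  \int[P x]_w f (Y t w).

Record feller_process P Y : Prop := {
  feller_cadlag : cadlag_process Y ;
  feller_start : forall x, {ae P x, forall w, Y 0 w = x} ;
  feller_markov : forall x (s t : R) (f : T -> R) (A : set W),
    0 <= s -> 0 <= t -> continuous f -> natural_filtration Y s A ->
    \int[P x]_(w in A) f (Y (s + t) w) =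
    \int[P x]_(w in A) semigroup P Y t f (Y s w) ;
  feller_continuous : forall (t : R) (f : T -> R),
    0 <= t -> continuous f -> continuous (semigroup P Y t f) ;
  feller_strongly_continuous : forall f : T -> R, continuous f ->
    {uniform, semigroup P Y t f @[t --> 0^'+] --> f} }.

(** [f] is in the domain of the generator [L] of the semigroup, and [L f = g]. *)
Definition generator P Y (f g : T -> R) : Prop :=
  [/\ continuous f, continuous g &
    {uniform, (fun x => t^-1 * (semigroup P Y t f x - f x)) @[t --> 0^'+] --> g}].

Definition stationary P Y (mu : probability (borel T) R) : Prop :=
  forall (t : R) (f : T -> R), 0 <= t -> continuous f ->
    \int[mu]_x semigroup P Y t f x = \int[mu]_x f x.

Definition ergodic P Y (mu : probability (borel T) R) : Prop :=
  stationary P Y mu /\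
  forall A : set (borel T), measurable A ->
    (forall t : R, 0 <= t ->
      {ae mu, forall x, P x [set w | A (Y t w)] = (\1_A x)%:E}) ->
    mu A = 0%E \/ mu A = 1%E.

Definition stopping_time Y (tau : W -> \bar R) : Prop :=
  (forall w, (0 <= tau w)%E) /\
  forall t : R, 0 <= t -> natural_filtration Y t [set w | (tau w <= t%:E)%E].

Definition stopped_event Y (tau : W -> \bar R) (A : set W) : Prop :=
  measurable A /\
  forall t : R, 0 <= t ->
    natural_filtration Y t (A `&` [set w | (tau w <= t%:E)%E]).

Record strong_markov_process P Y : Prop := {
  strong_markov_cadlag : cadlag_process Y ;
  strong_markov_start : forall x, {ae P x, forall w, Y 0 w = x} ;
  strong_markov_kernel : forall B, path_event B ->
    measurable_fun [set: borel T]
      ((fun x => P x [set w | B (Y ^~ w)]) : borel T -> \bar R) ;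
  strong_markov_property : forall x (tau : W -> \bar R) (A : set W) B,
    stopping_time Y tau -> stopped_event Y tau A ->
    A `<=` [set w | (tau w < +oo)%E] -> path_event B ->
    P x (A `&` [set w | B (fun t => Y (fine (tau w) + t) w)]) =
    (\int[P x]_(w in A) P (Y (fine (tau w)) w) [set w' | B (Y ^~ w')])%E }.

End Process.

Definition strong_markov_coupling {R : realType} {T : ptopologicalType}
    {dW dV : measure_display} {W : measurableType dW} {V : measurableType dV}
    (P : T -> probability W R) (Y : R -> W -> T)
    (Phat : T * T -> probability V R) (Z : R -> V -> T * T) : Prop :=
  strong_markov_process Phat Z /\
  forall x y B, path_event B ->
    Phat (x, y) [set w | B (fun t => (Z t w).1)] = P x [set w | B (Y ^~ w)] /\
    Phat (x, y) [set w | B (fun t => (Z t w).2)] = P y [set w | B (Y ^~ w)].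

(** * Configurations and Lipschitz functions *)

Notation Zd d := 'rV[int]_d.
Notation Omega d E := {ptws Zd d -> E}.

Section Configurations.
Context {R : realType} {d : nat} {E : pmetricType R}.

Definition translate (x : Zd d) (eta : Omega d E) : Omega d E :=
  fun y => eta (y - x).

Definition embed (z : Zd d) : 'rV[R]_d := map_mx intr z.

(** Sum of an absolutely convergent family indexed by [Zd d]. *)
Definition sumZ (f : Zd d -> R) : R :=
  fine (\esum_(z in [set: Zd d]) (Num.max (f z) 0)%:E -
        \esum_(z in [set: Zd d]) (Num.max (- f z) 0)%:E)%E.

Definition differ_at (x : Zd d) : set (Omega d E * Omega d E) :=
  [set p | p.1 x <> p.2 x /\ forall y, y <> x -> p.1 y = p.2 y].

(** The supremum is nonnegative by symmetry of [differ_at x]; the maximum with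
  [0] only matters when [E] is a singleton and [differ_at x] is empty. *)
Definition delta (f : Omega d E -> R) (x : Zd d) : \bar R :=
  maxe 0%E (ereal_sup [set ((f p.1 - f p.2) / mdist (p.1 x) (p.2 x))%:E
                      | p in differ_at x]).

Definition triple_norm (f : Omega d E -> R) : \bar R :=
  \esum_(x in [set: Zd d]) delta f x.

Definition triple_norm1 (beta : Omega d E -> Zd d -> R) : \bar R :=
  \esum_(z in [set: Zd d]) (`|embed z|%:E * triple_norm (beta ^~ z))%E.

Record admissible (alpha : Omega d E -> Zd d -> R) : Prop := {
  rate_ge0 : forall eta z, 0 <= alpha eta z ;
  rate_continuous : forall z, continuous (alpha ^~ z) ;
  rate_norm1 : (\esum_(z in [set: Zd d])
    (`|embed z|%:E * ereal_sup [set `|alpha eta z|%:E | eta in setT]) < +oo)%E ;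
  rate_triple_norm :
    (\esum_(z in [set: Zd d]) triple_norm (alpha ^~ z) < +oo)%E }.

End Configurations.

Section Environment.
Context {R : realType} {d : nat} {E : pmetricType R}.
Context {dW dV : measure_display} {W : measurableType dW} {V : measurableType dV}.

Definition translation_invariant (P : Omega d E -> probability W R)
    (Y : R -> W -> Omega d E) : Prop :=
  forall x eta (t : R) (A : set (borel (Omega d E))), 0 <= t -> measurable A ->
    P eta [set w | A (translate x (Y t w))] = P (translate x eta) [set w | A (Y t w)].

Definition coupling_translation_invariant
    (Phat : Omega d E * Omega d E -> probability V R)
    (Z : R -> V -> Omega d E * Omega d E) : Prop :=
  forall x eta xi (t : R) (A : set (borel (Omega d E * Omega d E)%type)),
    0 <= t -> measurable A ->
    Phat (eta, xi) [set w | A (translate x (Z t w).1, translate x (Z t w).2)] =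
    Phat (translate x eta, translate x xi) [set w | A (Z t w)].

End Environment.

(** * The random walk *)

Section Walker.
Context {R : realType} {d : nat} {E : pmetricType R}.
Context {dW : measure_display} {W : measurableType dW}.
Context (P : Omega d E -> probability W R) (Y : R -> W -> Omega d E).
Implicit Types (alpha : Omega d E -> Zd d -> R) (F G : Omega d E -> Zd d -> R).

(** With [G eta x = (L^E F(., x)) eta], the generator of the joint process of
  environment and walker is
  [L F (eta, x) =
     L^E F(., x) (eta) + sum_z alpha (translate (- x) eta, z) (F (eta, x + z) - F (eta, x))]. *)
Definition joint_generator alpha F G (eta : Omega d E) (x : Zd d) : R :=
  G eta x + sumZ (fun z => alpha (translate (- x) eta) z * (F eta (x + z) - F eta x)).

Definition joint_domain F G : Prop :=
  (forall x, generator P Y (F ^~ x) (G ^~ x)) /\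
  exists K, forall eta x, `|F eta x| <= K /\ `|G eta x| <= K.

Section Path.
Context {dV : measure_display} {V : measurableType dV}.
Context (Q : probability V R) (eta : R -> V -> Omega d E) (X : R -> V -> Zd d).

Definition joint_filtration (t : R) : set (set V) :=
  <<s [set A | exists (s : R) (B : set (borel (Omega d E))) (x : Zd d),
        [/\ 0 <= s <= t, measurable B & A = eta s @^-1` B \/ A = X s @^-1` [set x]]] >>.

(** [(eta_t, X_t)] is the process on [Omega d E * Zd d] with generator [L] above,
  in the sense of the martingale problem, started from [(eta0, 0)]. *)
Record walker alpha (eta0 : Omega d E) : Prop := {
  walker_env : cadlag_process eta ;
  walker_measurable : forall (t : R) x, 0 <= t -> measurable (X t @^-1` [set x]) ;
  walker_right : forall w (t : R), 0 <= t -> \forall u \near t^'+, X u w = X t w ;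
  walker_left : forall w (t : R), 0 < t ->
    exists x, \forall u \near t^'-, X u w = x ;
  walker_start : {ae Q, forall w, eta 0 w = eta0 /\ X 0 w = 0} ;
  walker_martingale : forall F G (s t : R) (A : set V),
    joint_domain F G -> 0 <= s <= t -> joint_filtration s A ->
    \int[Q]_(w in A) (F (eta t w) (X t w) - F (eta s w) (X s w)) =
    \int[Q]_(w in A) \int[lebesgue_measure]_(u in `[s, t])
      joint_generator alpha F G (eta u w) (X u w) }.

End Path.

(** The martingale problem determines the law of the walker, hence the speed
  does not depend on which of its realizations is considered. *)
Definition asymptotic_speed alpha (v : 'rV[R]_d) : Prop :=
  forall eta0, exists (dV : measure_display) (V : measurableType dV)
    (Q : probability V R) (eta : R -> V -> Omega d E) (X : R -> V -> Zd d),
    walker Q eta X alpha eta0 /\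
    {ae Q, forall w, T^-1 *: embed (X T w) @[T --> +oo] --> v}.

Definition mean_drift alpha (mu : probability (borel (Omega d E)) R) : 'rV[R]_d :=
  \row_i \int[mu]_eta sumZ (fun z => (z ord0 i)%:~R * alpha eta z).

End Walker.

(* Main.v *)
Require Import Defs.
From HB Require Import structures.
From mathcomp Require Import all_boot all_order all_algebra.
From mathcomp Require Import all_classical all_reals all_analysis.
From mathcomp Require Import measurable_realfun.
From mathcomp Require Import ring lra.

Set Implicit Arguments.
Unset Strict Implicit.
Unset Printing Implicit Defensive.

Import Order.TTheory GRing.Theory Num.Theory.
Import numFieldNormedType.Exports.

Local Open Scope classical_set_scope.
Local Open Scope ring_scope.

(** Freeze the jump rates at one configuration.  The reference walk so obtained
  is independent of the environment.  Let [L] be the generator of the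
  environment and [A] the generator of the jumps of the reference walk, acting
  on functions of the environment seen from the walker, and let [f] be the local
  drift centered by [muE].  The two semigroups commute, so that [L u + A u = - f]
  is solved, up to an arbitrarily small error, by an integral of the orbit of
  [f], and the coupling gives [|u| <= |||f||| (1 + J)], where [J] is the integral
  in the decay hypothesis and the summand [1] accounts for the times [t <= 1].
  Insert [x_i + u (translate (- x) eta)] into the martingale problem of the
  actual walker: the speed differs from the mean drift by the time average of
  [sum_z (alpha (eta, z) - alpha (eta*, z)) (u (translate (- z) eta) - u eta)],
  where [eta*] is the configuration at which the rates are frozen.  The
  oscillation of the rates is at most [C eps], and so is [|||f|||], whence the
  constant [2 (1 + J) C ^ 2].

  The coordinate function is unbounded and is truncated at a multiple of the
  time horizon; the law of large numbers for the walker makes this harmless. *)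

Section Integration.
Context {R : realType} {dT : measure_display} {T : measurableType dT}.
Implicit Type mu : {measure set T -> \bar R}.

(* The integral of a nonnegative function is a supremum over the simple
  functions below it, so that monotonicity needs no measurability. *)
Lemma le_integral_nonmeasurable mu (D : set T) (f g : T -> \bar R) :
  (forall x, D x -> (f x <= g x)%E) ->
  (\int[mu]_(x in D) f x <= \int[mu]_(x in D) g x)%E.
Proof.
move=> fg; have fgD x : ((f \_ D) x <= (g \_ D) x)%E.
  by rewrite !patchE; case: ifPn => // /set_mem /fg.
rewrite /integral; apply: leeB.
  apply: le_ereal_sup => _ [h /= hf <-]; exists h => //= x.
  by apply: (le_trans (hf x)); rewrite !funeposE ge_max !le_max fgD lexx orbT.
apply: le_ereal_sup => _ [h /= hf <-]; exists h => //= x.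
apply: (le_trans (hf x)).
by rewrite !funenegE ge_max !le_max leeN2 fgD lexx orbT.
Qed.

Lemma bounded_integrable mu (D : set T) (f : T -> R) (K : R) :
  measurable D -> (mu D < +oo)%E -> measurable_fun D f ->
  (forall x, D x -> `|f x| <= K) -> mu.-integrable D (EFin \o f).
Proof.
move=> mD muD mf fK; apply: measurable_bounded_integrable => //.
exists K; split; first exact: num_real.
by move=> x Kx y /= Dy; rewrite (le_trans (fK y Dy)) ?ltW.
Qed.

Lemma probability_lty (Q : probability T R) : (Q setT < +oo)%E.
Proof. by apply: (@le_lt_trans _ _ 1%E); [exact: probability_le1|exact: ltry]. Qed.

Lemma Rintegral_between mu (D : set T) (l f u : T -> R) :
  measurable D -> mu.-integrable D (EFin \o l) ->
  mu.-integrable D (EFin \o u) ->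
  (forall x, D x -> l x <= f x <= u x) ->
  \int[mu]_(x in D) l x <= \int[mu]_(x in D) f x <= \int[mu]_(x in D) u x.
Proof.
move=> mD il iu lfu.
have lf : (\int[mu]_(x in D) (l x)%:E <= \int[mu]_(x in D) (f x)%:E)%E.
  by apply: le_integral_nonmeasurable => x /lfu/andP[]; rewrite lee_fin.
have fu : (\int[mu]_(x in D) (f x)%:E <= \int[mu]_(x in D) (u x)%:E)%E.
  by apply: le_integral_nonmeasurable => x /lfu/andP[]; rewrite lee_fin.
have fl : (\int[mu]_(x in D) (l x)%:E \is a fin_num)%E.
  exact: integrable_fin_num.
have fiu : (\int[mu]_(x in D) (u x)%:E \is a fin_num)%E.
  exact: integrable_fin_num.
have ff : (\int[mu]_(x in D) (f x)%:E \is a fin_num)%E.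
  rewrite fin_numE; apply/andP; split; apply/eqP => e.
    by move: lf fl; rewrite e leeNy_eq => /eqP ->.
  by move: fu fiu; rewrite e leye_eq => /eqP ->.
by rewrite /Rintegral !fine_le.
Qed.

Lemma probability_Rintegral_cst (Q : probability T R) (c : R) :
  \int[Q]_x c = c.
Proof.
rewrite Rintegral_cst// (_ : fine _ = 1) ?mulr1//.
exact: (congr1 fine (probability_setT Q)).
Qed.

Lemma probability_Rintegral_between (Q : probability T R) (l u : R) (f : T -> R) :
  (forall x, l <= f x <= u) -> l <= \int[Q]_x f x <= u.
Proof.
move=> lfu; rewrite -(probability_Rintegral_cst Q l).
rewrite -(probability_Rintegral_cst Q u).
have ic c : Q.-integrable setT (EFin \o (fun=> c : R)).
  by apply: (@bounded_integrable _ _ _ (`|c|)) => //; exact: probability_lty.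
by apply: Rintegral_between => // x _; exact: lfu.
Qed.

End Integration.

(** * The semigroup of a Feller process *)

Lemma near_rightP {R : realType} (x : R) (A : R -> Prop) :
  (\forall t \near x^'+, A t) <->
  exists2 e : R, 0 < e & forall t, x < t < x + e -> A t.
Proof.
split=> [|[e e0 eA]].
  rewrite /at_right /within /= => /nbhs_ballP[e /= e0 eA].
  exists e => // t /andP[xt te]; apply: eA => //=.
  by rewrite /ball /= ltr0_norm ?subr_lt0 // opprB ltrBlDl.
near=> t; apply: eA; apply/andP; split; near: t; first exact: nbhs_right_gt.
by apply: nbhs_right_lt; rewrite ltrDl.
Unshelve. all: by end_near. Qed.

Lemma uniform_cvg_rightP {R : realType} {T : ptopologicalType}
    (F : R -> T -> R) (G : T -> R) :
  {uniform, F t @[t --> 0^'+] --> G} <->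
  forall e : R, 0 < e -> exists2 d : R, 0 < d &
    forall t, 0 < t < d -> forall x, `|F t x - G x| <= e.
Proof.
split=> [FG e e0|FG A].
  have /FG : nbhs (G : {uniform T -> R})
      [set h | forall y, [set: T] y -> `|G y - h y| < e].
    apply/uniform_nbhs; exists [set p | ball p.1 e p.2]; split => //.
    by rewrite -entourage_ballE; exists e.
  move=> /near_rightP[d d0 dF]; exists d => // t td x.
  by rewrite distrC ltW // dF // add0r.
move=> /uniform_nbhs[E [/= entE EA]].
change (\forall t \near 0^'+, A (F t)).
move: entE; rewrite -entourage_ballE => -[e /= e0 eE].
have [d d0 dF] := FG _ (divr_gt0 e0 (ltr0n R 2)).
apply/near_rightP; exists d => // t; rewrite add0r => td.
apply: EA => y _; apply: eE; rewrite /ball /= distrC (le_lt_trans (dF _ td y)) //.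
by rewrite ltr_pdivrMr // mulr_natr mulr2n ltrDl.
Qed.

Lemma continuous_measurable_borel {T U : ptopologicalType} (f : T -> U) :
  continuous f -> measurable_fun setT (f : borel T -> borel U).
Proof.
move=> cf; apply: (@measurability _ _ (borel T) (borel U) setT f open erefl) => _ [A oA <-].
by apply: sub_sigma_algebra; rewrite setTI; exact: open_comp.
Qed.

Lemma continuous_measurable_real {R : realType} {T : ptopologicalType}
    (f : T -> R) :
  continuous f -> measurable_fun setT (f : borel T -> R).
Proof.
move=> cf; apply: (@measurability _ _ (borel T) R setT f _ (RGenOpens.measurableE R)).
move=> _ [_ [x [y ->]] <-]; apply: sub_sigma_algebra; rewrite setTI.
by apply: open_comp => //; exact: interval_open.
Qed.

Lemma generated_sigma_algebraT {T : Type} (G : set (set T)) : <<s G >> setT.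
Proof.
have := @sigma_algebraCD _ setT G _ (@sigma_algebra0 _ setT G).
by rewrite setD0.
Qed.

Section BoundedContinuous.
Context {R : realType} {T : ptopologicalType}.

Definition bcont (f : T -> R) : Prop :=
  continuous f /\ exists K, forall x, `|f x| <= K.

Lemma bcont_cst c : bcont (cst c).
Proof. by split; [exact: cst_continuous|exists `|c|]. Qed.

Lemma bcontD f g : bcont f -> bcont g -> bcont (fun x => f x + g x).
Proof.
move=> [cf [K fK]] [cg [L gL]]; split.
  by move=> x; apply: continuousD; [exact: cf|exact: cg].
by exists (K + L) => x; rewrite (le_trans (ler_normD _ _)) // lerD.
Qed.

Lemma bcontM c f : bcont f -> bcont (fun x => c * f x).
Proof.
move=> [cf [K fK]]; split.
  by move=> x; apply: continuousM; [exact: cst_continuous|exact: cf].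
by exists (`|c| * K) => x; rewrite normrM ler_wpM2l.
Qed.

Lemma bcontB f g : bcont f -> bcont g -> bcont (fun x => f x - g x).
Proof.
move=> bf /(bcontM (-1)) bg.
have -> : (fun x => f x - g x) = (fun x => f x + (-1) * g x).
  by apply/funext => x; rewrite mulN1r.
exact: bcontD.
Qed.

Lemma bcont_sum (I : Type) (r : seq I) (f : I -> T -> R) :
  (forall i, bcont (f i)) -> bcont (fun x => \sum_(i <- r) f i x).
Proof.
move=> bf; elim: r => [|i r IH].
  by have := bcont_cst 0; congr bcont; apply/funext => x; rewrite big_nil.
have := bcontD (bf i) IH; congr bcont; apply/funext => x.
by rewrite big_cons.
Qed.

End BoundedContinuous.

Section Expectation.
Context {R : realType} {T : ptopologicalType}.
Context {dW : measure_display} {W : measurableType dW}.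
Context {P : T -> probability W R} {Y : R -> W -> T}.
Hypothesis cY : cadlag_process Y.
Local Notation S := (semigroup P Y).

Lemma semigroup_integrable t f : 0 <= t -> bcont f -> forall x,
  (P x).-integrable setT (EFin \o (fun w => f (Y t w))).
Proof.
move=> t0 [cf [K fK]] x; apply: (@bounded_integrable _ _ _ _ _ _ K) => //.
- exact: probability_lty.
- apply: (measurableT_comp (continuous_measurable_real cf)).
  exact: (process_measurable cY t0).
Qed.

Lemma semigroupD t f g : 0 <= t -> bcont f -> bcont g -> forall x,
  S t (fun y => f y + g y) x = S t f x + S t g x.
Proof. by move=> *; rewrite /semigroup RintegralD//; exact: semigroup_integrable. Qed.

Lemma semigroupM t c f : 0 <= t -> bcont f -> forall x,
  S t (fun y => c * f y) x = c * S t f x.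
Proof. by move=> *; rewrite /semigroup RintegralZl//; exact: semigroup_integrable. Qed.

Lemma semigroupB t f g : 0 <= t -> bcont f -> bcont g -> forall x,
  S t (fun y => f y - g y) x = S t f x - S t g x.
Proof. by move=> *; rewrite /semigroup RintegralB//; exact: semigroup_integrable. Qed.

Lemma semigroup_cst t c x : S t (cst c) x = c.
Proof.
exact: probability_Rintegral_cst.
Qed.

Lemma semigroup_sum t (I : Type) (r : seq I) (f : I -> T -> R) : 0 <= t ->
  (forall i, bcont (f i)) -> forall x,
  S t (fun y => \sum_(i <- r) f i y) x = \sum_(i <- r) S t (f i) x.
Proof.
move=> t0 bf x; elim: r => [|i r IH].
  rewrite big_nil -[RHS](semigroup_cst t 0 x); congr (S t _ x).
  by apply/funext => y; rewrite big_nil.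
rewrite big_cons -IH -semigroupD //; last exact: bcont_sum.
by congr (S t _ x); apply/funext => y; rewrite big_cons.
Qed.

Lemma semigroup_le t f g : 0 <= t -> bcont f -> bcont g ->
  (forall x, f x <= g x) -> forall x, S t f x <= S t g x.
Proof.
move=> t0 bf bg fg x; apply: le_Rintegral => //; exact: semigroup_integrable.
Qed.

Lemma semigroup_norm t f K : (forall x, `|f x| <= K) -> forall x, `|S t f x| <= K.
Proof.
move=> fK x; rewrite ler_norml; apply: probability_Rintegral_between => w.
by rewrite -ler_norml.
Qed.

End Expectation.

Section Semigroup.
Context {R : realType} {T : ptopologicalType}.
Context {dW : measure_display} {W : measurableType dW}.
Context {P : T -> probability W R} {Y : R -> W -> T}.
Hypothesis PY : feller_process P Y.
Local Notation S := (semigroup P Y).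
Let cY := feller_cadlag PY.

Lemma bcont_semigroup t f : 0 <= t -> bcont f -> bcont (S t f).
Proof.
move=> t0 bf; have [cf [K fK]] := bf.
split; first exact: (feller_continuous PY).
by exists K; exact: semigroup_norm.
Qed.

Lemma semigroup_comp s t f : 0 <= s -> 0 <= t -> bcont f -> forall x,
  S (s + t) f x = S s (S t f) x.
Proof.
move=> s0 t0 [cf _] x; apply: (feller_markov PY) => //.
exact: generated_sigma_algebraT.
Qed.

Lemma semigroup0 f x : bcont f -> S 0 f x = f x.
Proof.
move=> bf; rewrite /semigroup -[RHS](probability_Rintegral_cst (P x)).
congr fine; apply: ae_eq_integral => //.
- exact: (measurable_int _ (semigroup_integrable cY (lexx 0) bf x)).
- by apply: filterS (feller_start PY x) => w /= ->.
Qed.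

Lemma semigroup_near0 f : bcont f -> forall e : R, 0 < e ->
  exists2 d : R, 0 < d & forall t, 0 <= t < d -> forall x, `|S t f x - f x| <= e.
Proof.
move=> bf e e0.
have /uniform_cvg_rightP/(_ _ e0)[d d0 dF] := feller_strongly_continuous PY bf.1.
exists d => // t /andP[]; rewrite le_eqVlt => /predU1P[<- _ x|t0 td x].
  by rewrite semigroup0 // subrr normr0 ltW.
by apply: dF; rewrite t0.
Qed.

Lemma semigroup_equicontinuous f (e d : R) : bcont f ->
  (forall t, 0 <= t < d -> forall x, `|S t f x - f x| <= e) ->
  forall s t, 0 <= s -> 0 <= t -> `|s - t| < d ->
    forall x, `|S s f x - S t f x| <= e.
Proof.
move=> bf de.
have key s t : 0 <= s -> s <= t -> `|s - t| < d ->
    forall x, `|S s f x - S t f x| <= e.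
  move=> s0 st std x; have ts : 0 <= t - s by rewrite subr_ge0.
  rewrite -{1}(subrKC s t) semigroup_comp // -(semigroupB cY) //; last exact: bcont_semigroup.
  apply: semigroup_norm => y.
  by rewrite distrC de // ts /= -[_ - _]ger0_norm // distrC.
move=> s t s0 t0 std x; have [st|/ltW ts] := leP s t; first exact: key.
by rewrite distrC key // distrC.
Qed.

End Semigroup.

Lemma eq_of_small_dist {R : realType} (x y : R) :
  (forall e : R, 0 < e -> `|x - y| <= e) -> x = y.
Proof.
move=> h; apply/eqP; rewrite -subr_eq0 -normr_le0.
by apply/ler_addgt0Pl => e e0; rewrite addr0; exact: h.
Qed.

Lemma exists_div_lt {R : realType} (h d : R) : 0 < d ->
  exists n : nat, h / n.+1%:R < d.
Proof.
move=> d0; exists (Num.bound `|h / d|).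
rewrite ltr_pdivrMr // mulrC -ltr_pdivrMr //.
apply: (le_lt_trans (ler_norm _)); apply: (lt_trans (archi_boundP (normr_ge0 _))).
by rewrite ltr_nat.
Qed.

Section TimeIntegral.
Context {R : realType}.
Notation leb := (@lebesgue_measure R).
Implicit Types q r : R -> R.

Definition uequicont q : Prop := forall e : R, 0 < e ->
  exists2 d : R, 0 < d & forall s t, `|s - t| < d -> `|q s - q t| <= e.

Lemma uequicont_continuous q : uequicont q -> continuous q.
Proof.
move=> uq x; apply/cvgrPdist_le => e e0; have [d d0 dq] := uq _ e0.
apply/nbhs_ballP; exists d => //= y; rewrite /ball /= => xy.
exact: dq.
Qed.

Lemma continuous_itv_integrable q a b : continuous q ->
  leb.-integrable `[a, b] (EFin \o q).
Proof.
move=> cq; apply: continuous_compact_integrable; first exact: segment_compact.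
exact: continuous_subspaceT.
Qed.

Lemma Rintegral_itv_cat q a b c : continuous q -> a <= b -> b <= c ->
  \int[leb]_(t in `[a, c]) q t =
  \int[leb]_(t in `[a, b]) q t + \int[leb]_(t in `[b, c]) q t.
Proof.
move=> cq ab bc.
rewrite -(Rintegral_itv_obnd_cbnd (r := b)).
  rewrite -(@Rintegral_itvB _ _ (BLeft a) (BRight c)) ?bnd_simp //.
    by rewrite subrKC.
  exact: continuous_itv_integrable.
apply: (integrableS _ _ _ (continuous_itv_integrable b c cq)) => //.
exact: subset_itv_oc_cc.
Qed.

Lemma Rintegral_itv_cst a b (c : R) : a <= b ->
  \int[leb]_(t in `[a, b]) c = (b - a) * c.
Proof.
move=> ab; rewrite Rintegral_cst //= lebesgue_measure_itv /= lte_fin.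
move: ab; rewrite le_eqVlt => /predU1P[->|->]; first by rewrite ltxx subrr mulr0 mul0r.
by rewrite mulrC.
Qed.

Lemma Rintegral_itv_close q a b c e : continuous q -> a <= b ->
  (forall t, a <= t <= b -> `|q t - c| <= e) ->
  `|\int[leb]_(t in `[a, b]) q t - (b - a) * c| <= (b - a) * e.
Proof.
move=> cq ab qc.
have := @Rintegral_between _ _ _ leb `[a, b]%classic (fun=> c - e) q (fun=> c + e).
rewrite !Rintegral_itv_cst // ler_distl -mulrBr -mulrDr; apply => //.
- by apply: continuous_itv_integrable => ?; exact: cst_continuous.
- by apply: continuous_itv_integrable => ?; exact: cst_continuous.
- by move=> t; rewrite /= in_itv /= => /qc; rewrite ler_distl.
Qed.

Lemma riemann_sum q a (d e dl : R) (n : nat) : continuous q ->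
  (forall s t, `|s - t| < d -> `|q s - q t| <= e) -> 0 <= dl < d ->
  `|\int[leb]_(t in `[a, a + n%:R * dl]) q t -
     dl * \sum_(k < n) q (a + k%:R * dl)| <= n%:R * dl * e.
Proof.
move=> cq dq /andP[dl0 dld]; elim: n => [|n IH].
  rewrite mul0r addr0 set_itv1 Rintegral_set1 big_ord0 mulr0 subrr normr0.
  by rewrite mul0r.
have nd0 : 0 <= n%:R * dl by rewrite mulr_ge0.
rewrite (@Rintegral_itv_cat _ _ (a + n%:R * dl)) ?lerDl //; last first.
  by rewrite lerD2l ler_wpM2r // ler_nat.
rewrite big_ord_recr /= mulrDr opprD addrACA.
apply: (le_trans (ler_normD _ _)).
rewrite -natr1 !mulrDl mul1r lerD //.
have := @Rintegral_itv_close q (a + n%:R * dl) (a + (n%:R * dl + dl))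
  (q (a + n%:R * dl)) e cq.
rewrite (_ : a + (n%:R * dl + dl) - (a + n%:R * dl) = dl); last by ring.
apply; first by rewrite addrA lerDl.
move=> t /andP[t1 t2]; apply: dq; rewrite ger0_norm ?subr_ge0 //.
by rewrite (le_lt_trans _ dld) // lerBlDr; lra.
Qed.

Lemma Rintegral_itv_shift q a s h : uequicont q -> 0 <= h ->
  \int[leb]_(t in `[a, a + h]) q (s + t) =
  \int[leb]_(t in `[s + a, s + a + h]) q t.
Proof.
move=> uq h0; apply: eq_of_small_dist => e e0.
have cq := uequicont_continuous uq.
have e'0 : 0 < e / (2 * (h + 1)) by rewrite divr_gt0 // mulr_gt0 // ltr_wpDl.
have [d d0 dq] := uq _ e'0.
have [n nd] := exists_div_lt h d0.
set dl := h / n.+1%:R.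
have dl0 : 0 <= dl < d by rewrite nd andbT divr_ge0.
have hE : h = n.+1%:R * dl by rewrite /dl mulrC divfK.
have cqs : continuous (fun t => q (s + t)).
  move=> t; apply: (@continuous_comp _ _ _ (fun t => s + t) q); last exact: cq.
  by apply: continuousD; [exact: cst_continuous|exact: cvg_id].
have dqs s' t : `|s' - t| < d -> `|q (s + s') - q (s + t)| <= e / (2 * (h + 1)).
  by move=> st; apply: dq; rewrite opprD addrACA subrr add0r.
have r1 := riemann_sum a n.+1 cqs dqs dl0.
have r2 := riemann_sum (s + a) n.+1 cq dq dl0.
have sE : \sum_(k < n.+1) q (s + (a + k%:R * dl)) =
    \sum_(k < n.+1) q (s + a + k%:R * dl).
  by apply: eq_bigr => k _; rewrite addrA.
rewrite -hE sE in r1; rewrite -hE in r2.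
rewrite -(subrKA (dl * \sum_(k < n.+1) q (s + a + k%:R * dl))).
apply: (le_trans (ler_normD _ _)).
rewrite distrC in r2.
apply: (le_trans (lerD r1 r2)).
have h1 : h + 1 != 0 by rewrite gt_eqF // ltr_wpDl.
rewrite (_ : _ + _ = e * (h / (h + 1))); last by field.
apply: ler_piMr; first exact: ltW.
by rewrite ler_pdivrMr ?ltr_wpDl // mul1r lerDl.
Qed.

End TimeIntegral.

Section TimeAverage.
Context {R : realType} {T : ptopologicalType}.
Context {dW : measure_display} {W : measurableType dW}.
Context {P : T -> probability W R} {Y : R -> W -> T}.
Hypothesis PY : feller_process P Y.
Local Notation S := (semigroup P Y).
Let cY := feller_cadlag PY.
Local Notation leb := (@lebesgue_measure R).
Implicit Types (c e h s t K : R) (f g : T -> R).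

Definition time_integral (h : R) (f : T -> R) (x : T) : R :=
  \int[leb]_(t in `[0, h]) S `|t| f x.

Lemma orbit_equicontinuous f : bcont f -> forall e : R, 0 < e ->
  exists2 d : R, 0 < d & forall x (s t : R), `|s - t| < d ->
    `|S `|s| f x - S `|t| f x| <= e.
Proof.
move=> bf e e0; have [d d0 de] := semigroup_near0 PY bf e0.
exists d => // x s t st.
apply: (semigroup_equicontinuous PY bf de) => //.
exact: (le_lt_trans (ler_dist_dist _ _)).
Qed.

Lemma orbit_uequicont f x : bcont f -> uequicont (fun t : R => S `|t| f x).
Proof.
move=> bf e e0; have [d d0 de] := orbit_equicontinuous bf e0.
by exists d => // s t; exact: de.
Qed.

Lemma orbit_continuous f x : bcont f -> continuous (fun t : R => S `|t| f x).
Proof. by move=> bf; exact/uequicont_continuous/orbit_uequicont. Qed.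

Lemma time_integral_close h f c e : 0 <= h -> bcont f ->
  forall x, (forall t, 0 <= t <= h -> `|S t f x - c| <= e) ->
  `|time_integral h f x - h * c| <= h * e.
Proof.
move=> h0 bf x fc.
have := @Rintegral_itv_close R _ 0 h c e (@orbit_continuous f x bf) h0.
rewrite subr0; apply => t th; have /andP[t0 _] := th.
by rewrite (ger0_norm t0) fc.
Qed.

Lemma time_integral_norm h f K : 0 <= h -> bcont f -> (forall x, `|f x| <= K) ->
  forall x, `|time_integral h f x| <= h * K.
Proof.
move=> h0 bf fK x; rewrite -[time_integral _ _ _]subr0 -[X in _ - X](mulr0 h).
apply: time_integral_close => // t /andP[t0 _]; rewrite subr0.
exact: semigroup_norm.
Qed.

Lemma time_integral_riemann h f e : 0 <= h -> bcont f -> 0 < e ->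
  exists2 n : nat, 0 <= h / n%:R & forall s, 0 <= s -> forall x,
  `|\int[leb]_(t in `[0, h]) S `|s + t| f x -
    h / n%:R * \sum_(k < n) S (s + k%:R * (h / n%:R)) f x| <= h * e.
Proof.
move=> h0 bf e0; have [d d0 de] := orbit_equicontinuous bf e0.
have [n nd] := exists_div_lt h d0; exists n.+1; first by rewrite divr_ge0.
move=> s s0 x; set dl := h / _.
have dl0 : 0 <= dl by rewrite divr_ge0.
have cq : continuous (fun t : R => S `|s + t| f x).
  move=> t; apply: (@continuous_comp _ _ _ (fun t : R => s + t) (fun t : R => S `|t| f x)).
    by apply: continuousD; [exact: cst_continuous|exact: cvg_id].
  exact: (@orbit_continuous f x bf).
have := @riemann_sum R _ 0 d e dl n.+1 cq.
have hE : n.+1%:R * dl = h by rewrite /dl mulrC divfK.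
rewrite add0r hE => H; apply: le_trans (H _ _).
- rewrite le_eqVlt; apply/orP; left; apply/eqP; congr (`|_ - _ * _|).
  apply: eq_bigr => k _; rewrite add0r ger0_norm //.
  by rewrite addr_ge0 // mulr_ge0.
- by move=> u v uv; apply: de; rewrite opprD addrACA subrr add0r.
- by rewrite dl0.
Qed.

Lemma time_integral_riemann0 h f e (n : nat) :
  (forall s, 0 <= s -> forall x,
    `|\int[leb]_(t in `[0, h]) S `|s + t| f x -
      h / n%:R * \sum_(k < n) S (s + k%:R * (h / n%:R)) f x| <= h * e) ->
  forall x, `|time_integral h f x -
    h / n%:R * \sum_(k < n) S (k%:R * (h / n%:R)) f x| <= h * e.
Proof.
move=> hn x; apply: le_trans (hn 0 (lexx 0) x).
rewrite le_eqVlt; apply/orP; left; apply/eqP.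
rewrite (_ : time_integral h f x = \int[leb]_(t in `[0, h]) S `|0 + t| f x); last first.
  by apply: eq_Rintegral => t _; rewrite add0r.
do 3 congr (_ _); congr (_ * _).
by apply: eq_bigr => k _; rewrite add0r.
Qed.

Lemma bcont_close f : (forall e : R, 0 < e ->
  exists2 g, bcont g & forall x, `|f x - g x| <= e) -> bcont f.
Proof.
move=> fg; split.
  move=> x; apply/cvgrPdist_le => e e0.
  have e3 : 0 < e / 3 by rewrite divr_gt0.
  have [g [cg _] g3] := fg _ e3.
  have := cg x => /cvgrPdist_le/(_ _ e3); apply: filterS => y gxy.
  have -> : f x - f y = (f x - g x) + ((g x - g y) + (g y - f y)) by ring.
  apply: (le_trans (ler_normD _ _)).
  have := ler_normD (g x - g y) (g y - f y).
  have := g3 x; have := g3 y; rewrite (distrC (f y)); lra.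
have [g [_ [K gK]] g1] := fg 1 ltr01.
exists (1 + K) => x; rewrite -(subrK (g x) (f x)).
by rewrite (le_trans (ler_normD _ _)) // lerD.
Qed.

Lemma semigroup_time_integral h f s : 0 <= h -> 0 <= s -> bcont f -> bcont (time_integral h f) ->
  forall x, S s (time_integral h f) x = \int[leb]_(t in `[0, h]) S `|s + t| f x.
Proof.
move=> h0 s0 bf bt x; apply: eq_of_small_dist => e e0.
have e'0 : 0 < e / (2 * (h + 1)) by rewrite divr_gt0 // mulr_gt0 // ltr_wpDl.
have [n hn0 hn] := time_integral_riemann h0 bf e'0.
have r1 := hn _ s0 x.
have hn0' y : `|time_integral h f y -
    h / n%:R * \sum_(k < n) S (k%:R * (h / n%:R)) f y| <= h * (e / (2 * (h + 1))).
  exact: (time_integral_riemann0 hn).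
have k0 (k : 'I_n) : 0 <= k%:R * (h / n%:R) by rewrite mulr_ge0.
have bS (k : 'I_n) : bcont (S (k%:R * (h / n%:R)) f) by exact: bcont_semigroup.
have r2 : `|S s (time_integral h f) x -
    h / n%:R * \sum_(k < n) S (s + k%:R * (h / n%:R)) f x| <=
    h * (e / (2 * (h + 1))).
  rewrite (eq_bigr (fun k : 'I_n => S s (S (k%:R * (h / n%:R)) f) x)); last first.
    by move=> k _; rewrite (semigroup_comp PY).
  rewrite -(semigroup_sum cY) // -(semigroupM cY) //; last exact: bcont_sum.
  rewrite -(semigroupB cY) //; last exact/bcontM/bcont_sum.
  exact: semigroup_norm.
rewrite distrC in r1.
rewrite -(subrKA (h / n%:R * \sum_(k < n) S (s + k%:R * (h / n%:R)) f x)).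
apply: (le_trans (ler_normD _ _)); apply: (le_trans (lerD r2 r1)).
have h1 : h + 1 != 0 by rewrite gt_eqF // ltr_wpDl.
rewrite (_ : _ + _ = e * (h / (h + 1))); last by field.
apply: ler_piMr; first exact: ltW.
by rewrite ler_pdivrMr ?ltr_wpDl // mul1r lerDl.
Qed.

Lemma bcont_time_integral h f : 0 <= h -> bcont f -> bcont (time_integral h f).
Proof.
move=> h0 bf; apply: bcont_close => e e0.
have e'0 : 0 < e / (h + 1) by rewrite divr_gt0 // ltr_wpDl.
have [n hn0 hn] := time_integral_riemann h0 bf e'0.
exists (fun x => h / n%:R * \sum_(k < n) S (k%:R * (h / n%:R)) f x).
  apply: bcontM; apply: bcont_sum => k; apply: (bcont_semigroup PY) => //.
  by rewrite mulr_ge0.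
move=> x; apply: (le_trans (time_integral_riemann0 hn x)).
rewrite mulrCA; apply: ler_piMr; first exact: ltW.
by rewrite ler_pdivrMr ?ltr_wpDl // mul1r lerDl.
Qed.

Lemma time_integral_generator h f : 0 <= h -> bcont f ->
  generator P Y (time_integral h f) (fun x => S h f x - f x).
Proof.
move=> h0 bf; have bt := bcont_time_integral h0 bf.
split; first by case: bt.
  by case: (bcontB (bcont_semigroup PY h0 bf) bf).
apply/uniform_cvg_rightP => e e0.
have e2 : 0 < e / 2 by rewrite divr_gt0.
have [d d0 de] := orbit_equicontinuous bf e2.
exists d => // s /andP[s0 sd] x; have s0' := ltW s0.
have uq := @orbit_uequicont f x bf; have cq := @orbit_continuous f x bf.
have -> : S s (time_integral h f) x - time_integral h f x =
    \int[leb]_(t in `[h, h + s]) S `|t| f x -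
    \int[leb]_(t in `[0, s]) S `|t| f x.
  rewrite semigroup_time_integral //.
  have := Rintegral_itv_shift 0 s uq h0; rewrite addr0 !add0r => ->.
  have := Rintegral_itv_cat cq s0' (_ : s <= s + h); rewrite lerDl => /(_ h0) c1.
  have := Rintegral_itv_cat cq h0 (_ : h <= h + s); rewrite lerDl => /(_ s0') c2.
  rewrite /time_integral; move: c1; rewrite (addrC s h) c2 => c1.
  by rewrite -[X in X - _](addKr (\int[leb]_(t in `[0, s]) S `|t| f x)) -c1; ring.
have c1 := @Rintegral_itv_close R _ h (h + s) (S h f x) (e / 2) cq.
have c2 := @Rintegral_itv_close R _ 0 s (f x) (e / 2) cq.
rewrite addrAC subrr add0r in c1; rewrite subr0 in c2.
have {}c1 : `|\int[leb]_(t in `[h, h + s]) S `|t| f x - s * S h f x| <= s * (e / 2).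
  apply: c1 => [|t /andP[t1 t2]]; first by rewrite lerDl.
  rewrite -(ger0_norm h0); apply: de; rewrite ger0_norm ?subr_ge0 //.
  by rewrite ltrBlDl (le_lt_trans t2) // ltrD2l.
have {}c2 : `|\int[leb]_(t in `[0, s]) S `|t| f x - s * f x| <= s * (e / 2).
  apply: c2 => // t /andP[t1 t2].
  have := de x t 0; rewrite subr0 normr0 (semigroup0 PY) //; apply.
  by rewrite ger0_norm // (le_lt_trans t2).
rewrite -(ler_pM2l s0) -{1}(ger0_norm s0') -normrM mulrBr mulVKf ?gt_eqF //.
move: c1 c2; rewrite !ler_norml; lra.
Qed.

End TimeAverage.

(** * Approximate solutions of the Poisson equation *)

Section ApproximatePoisson.
Context {R : realType} {T : ptopologicalType}.
Context {dW : measure_display} {W : measurableType dW}.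
Context {P : T -> probability W R} {Y : R -> W -> T}.
Hypothesis PY : feller_process P Y.
Local Notation S := (semigroup P Y).
Let cY := feller_cadlag PY.
Context {I : Type} (r : seq I) (a : I -> R) (tau : I -> T -> T).
Hypothesis a_ge0 : forall i, 0 <= a i.
Hypothesis tau_continuous : forall i, continuous (tau i).
Hypothesis tau_semigroup : forall i (t : R) (g : T -> R) x,
  0 <= t -> bcont g -> S t (fun y => g (tau i y)) x = S t g (tau i x).
Implicit Types (c e h s t K : R) (f g : T -> R).

Let total_jump_rate := \sum_(i <- r) a i.

Definition jump_gen (g : T -> R) (x : T) : R :=
  \sum_(i <- r) a i * (g (tau i x) - g x).

Definition jump_step (h : R) (g : T -> R) (x : T) : R := g x + h * jump_gen g x.

Definition split_step (h : R) (g : T -> R) : T -> R := S h (jump_step h g).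

Lemma total_jump_rate_ge0 : 0 <= total_jump_rate.
Proof. exact: sumr_ge0. Qed.

Lemma bcont_comp_tau i g : bcont g -> bcont (fun y => g (tau i y)).
Proof.
move=> [cg [K gK]]; split; last by exists K.
by move=> x; apply: continuous_comp; [exact: tau_continuous|exact: cg].
Qed.

Lemma bcont_jump_gen g : bcont g -> bcont (jump_gen g).
Proof.
move=> bg; apply: bcont_sum => i; apply: bcontM; apply: bcontB => //.
exact: bcont_comp_tau.
Qed.

Lemma bcont_jump_step h g : bcont g -> bcont (jump_step h g).
Proof. by move=> bg; apply: bcontD => //; exact/bcontM/bcont_jump_gen. Qed.

Lemma bcont_split_step h g : 0 <= h -> bcont g -> bcont (split_step h g).
Proof. by move=> h0 bg; apply: (bcont_semigroup PY) => //; exact: bcont_jump_step. Qed.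

Lemma jump_genD f g x :
  jump_gen (fun y => f y + g y) x = jump_gen f x + jump_gen g x.
Proof. by rewrite /jump_gen -big_split; apply: eq_bigr => i _ /=; ring. Qed.

Lemma jump_genM c g x : jump_gen (fun y => c * g y) x = c * jump_gen g x.
Proof. by rewrite /jump_gen mulr_sumr; apply: eq_bigr => i _; ring. Qed.

Lemma jump_gen_norm g K : (forall x, `|g x| <= K) ->
  forall x, `|jump_gen g x| <= 2 * total_jump_rate * K.
Proof.
move=> gK x; rewrite /jump_gen; apply: (le_trans (ler_norm_sum _ _ _)).
rewrite (_ : 2 * total_jump_rate * K = total_jump_rate * (2 * K)); last by ring.
rewrite mulr_suml; apply: ler_sum => i _.
rewrite normrM (ger0_norm (a_ge0 i)) ler_wpM2l //.
apply: (le_trans (ler_normB _ _)); have := gK x; have := gK (tau i x); lra.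
Qed.

Lemma jump_step_norm h g K : 0 <= h -> h * total_jump_rate <= 1 ->
  (forall x, `|g x| <= K) -> forall x, `|jump_step h g x| <= K.
Proof.
move=> h0 hL gK x.
have -> : jump_step h g x =
    (1 - h * total_jump_rate) * g x + h * \sum_(i <- r) a i * g (tau i x).
  rewrite /jump_step /jump_gen (eq_bigr (fun i => a i * g (tau i x) - a i * g x)).
    by rewrite sumrB -mulr_suml -/total_jump_rate; ring.
  by move=> i _; rewrite mulrBr.
have -> : K = (1 - h * total_jump_rate) * K + h * (total_jump_rate * K) by ring.
apply: (le_trans (ler_normD _ _)); apply: lerD.
  by rewrite normrM ger0_norm ?subr_ge0 // ler_wpM2l ?subr_ge0.
rewrite normrM (ger0_norm h0) ler_wpM2l // /total_jump_rate mulr_suml.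
apply: (le_trans (ler_norm_sum _ _ _)); apply: ler_sum => i _.
by rewrite normrM (ger0_norm (a_ge0 i)) ler_wpM2l.
Qed.

Lemma split_step_norm h g K : 0 <= h -> h * total_jump_rate <= 1 -> bcont g ->
  (forall x, `|g x| <= K) -> forall x, `|split_step h g x| <= K.
Proof.
move=> h0 hL bg gK; apply: semigroup_norm.
exact: jump_step_norm.
Qed.

Lemma semigroup_jump_gen t g : 0 <= t -> bcont g ->
  S t (jump_gen g) = jump_gen (S t g).
Proof.
move=> t0 bg; apply/funext => x; rewrite (semigroup_sum cY) //; last first.
  by move=> i; apply: bcontM; apply: bcontB => //; exact: bcont_comp_tau.
apply: eq_bigr => i _; rewrite (semigroupM cY) //; last first.
  by apply: bcontB => //; exact: bcont_comp_tau.
rewrite (semigroupB cY) //; last exact: bcont_comp_tau.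
by rewrite tau_semigroup.
Qed.

Lemma semigroup_jump_step h t g : 0 <= t -> bcont g ->
  S t (jump_step h g) = jump_step h (S t g).
Proof.
move=> t0 bg; apply/funext => x; rewrite (semigroupD cY) //; last first.
  exact/bcontM/bcont_jump_gen.
rewrite (semigroupM cY) //; last exact: bcont_jump_gen.
by rewrite semigroup_jump_gen.
Qed.

Lemma semigroup_split_step h t g : 0 <= h -> 0 <= t -> bcont g ->
  S t (split_step h g) = split_step h (S t g).
Proof.
move=> h0 t0 bg; rewrite /split_step -semigroup_jump_step //.
have bj := bcont_jump_step h bg; apply/funext => x.
by rewrite -(semigroup_comp PY) // addrC (semigroup_comp PY).
Qed.

Lemma split_stepB h f g : 0 <= h -> bcont f -> bcont g ->
  split_step h (fun x => f x - g x) =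
  (fun x => split_step h f x - split_step h g x).
Proof.
move=> h0 bf bg; apply/funext => x; rewrite /split_step.
rewrite -(semigroupB cY) //; try exact: bcont_jump_step.
congr (S h _ x); apply/funext => y; rewrite /jump_step.
have := jump_genD f (fun y => -1 * g y) y; rewrite jump_genM => e.
rewrite (_ : (fun x => f x - g x) = (fun x => f x + -1 * g x)) ?e; first by ring.
by apply/funext => z; rewrite mulN1r.
Qed.

Lemma bcont_iter_split_step h g k : 0 <= h -> bcont g ->
  bcont (iter k (split_step h) g).
Proof. by move=> h0 bg; elim: k => // k IH; rewrite iterS; exact: bcont_split_step. Qed.

Lemma iter_split_step_norm h g K k : 0 <= h -> h * total_jump_rate <= 1 -> bcont g ->
  (forall x, `|S (k%:R * h) g x| <= K) ->
  forall x, `|iter k (split_step h) g x| <= K.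
Proof.
move=> h0 hL; elim: k g => [|k IH] g bg gK.
  by move=> x; have := gK x; rewrite mul0r (semigroup0 PY).
rewrite iterSr; apply: IH; first exact: bcont_split_step.
have kh0 : 0 <= k%:R * h by rewrite mulr_ge0.
have bj := bcont_jump_step h bg.
move=> x; rewrite /split_step -(semigroup_comp PY) //.
rewrite -[X in _ + X]mul1r -mulrDl natr1 semigroup_jump_step //; last first.
  by rewrite mulr_ge0.
exact: jump_step_norm.
Qed.

Lemma iter_split_step_orbit h f k s t e : 0 <= h -> h * total_jump_rate <= 1 ->
  0 <= s -> 0 <= t -> bcont f ->
  (forall x, `|S s f x - S t f x| <= e) -> forall x,
  `|S s (iter k (split_step h) f) x - S t (iter k (split_step h) f) x| <= e.
Proof.
move=> h0 hL s0 t0; elim: k f => // k IH f bf fe.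
rewrite iterSr; apply: IH; first exact: bcont_split_step.
move=> x; rewrite !semigroup_split_step //.
have bs := bcont_semigroup PY s0 bf; have bt := bcont_semigroup PY t0 bf.
have := split_stepB h0 bs bt => /(congr1 (fun g => g x)) /= <-.
by apply: split_step_norm => //; exact: bcontB.
Qed.

Section Solution.
Context (f : T -> R) (g : R -> R) (J : R).
Hypothesis bf : bcont f.
Hypothesis fg : forall t, 0 <= t -> forall x, `|S t f x| <= g t.
Hypothesis g_noninc : forall s t, 0 <= s -> s <= t -> g t <= g s.
Hypothesis gJ : forall h n, 0 <= h -> h * \sum_(k < n) g (k.+1%:R * h) <= J.

(* The Lie splitting of the joint flow of the environment and of the reference
  walk, summed over a long time horizon, is averaged over one time step in
  order to land in the domain of the generator of the environment. *)
Lemma approximate_poisson (e : R) : 0 < e -> exists u Lu : T -> R,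
  [/\ bcont u, bcont Lu, generator P Y u Lu,
      forall x, `|u x| <= J + e &
      forall x, `|Lu x + jump_gen u x + f x| <= e].
Proof.
move=> e0; have e2 : 0 < e / 2 by rewrite divr_gt0.
have g_ge0 t : 0 <= t -> 0 <= g t.
  by move=> t0; apply: le_trans (fg t0 point).
have J0 : 0 <= J by have := gJ 0 (lexx 0); rewrite big_ord0 mulr0.
have [N Ng] : exists N : nat, g N.+1%:R <= e / 2.
  have [N Ne] := exists_div_lt J e2; exists N.
  have N1 : (0 : R) < N.+1%:R by [].
  apply: le_trans (ltW Ne); rewrite ler_pdivlMr //.
  apply: le_trans (gJ N.+1 ler01); rewrite mul1r.
  apply: (@le_trans _ _ (\sum_(k < N.+1) g N.+1%:R)).
    by rewrite sumr_const card_ord mulr_natr.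
  apply: ler_sum => k _; rewrite mulr1; apply: g_noninc => //.
  by rewrite ler_nat.
set H : R := N.+1%:R; have H0 : 0 < H by [].
have L0 := total_jump_rate_ge0.
set w0 := e / 2 / (2 * total_jump_rate * H + 1).
have D0 : 0 < 2 * total_jump_rate * H + 1 by rewrite ltr_wpDl // !mulr_ge0.
have w00 : 0 < w0 by rewrite divr_gt0.
have [d d0 de] := semigroup_near0 PY bf w00.
have g00 : 0 <= g 0 by exact: g_ge0.
pose d' := Num.min d (Num.min (1 / (total_jump_rate + 1)) (e / (g 0 + 1))).
have d'0 : 0 < d' by rewrite !lt_min d0 /= !divr_gt0 // ltr_wpDl.
have [n] := exists_div_lt H d'0.
set h := H / n.+1%:R; rewrite !lt_min => /and3P[hd hL' hg'].
have h0 : 0 < h by rewrite divr_gt0.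
have h0' := ltW h0.
have hH : n.+1%:R * h = H by rewrite /h mulrC divfK.
have hL : h * total_jump_rate <= 1.
  move: hL'; rewrite ltr_pdivlMr ?ltr_wpDl // => /ltW; apply: le_trans.
  by rewrite ler_wpM2l // lerDl.
have hg : h * g 0 <= e.
  move: hg'; rewrite ltr_pdivlMr ?ltr_wpDl // => /ltW; apply: le_trans.
  by rewrite ler_wpM2l // lerDl.
pose F (k : nat) := iter k (split_step h) f.
have bF (k : nat) : bcont (F k) by exact: bcont_iter_split_step.
have FK k (x : T) : `|F k x| <= g (k%:R * h).
  by apply: iter_split_step_norm => //; apply: fg; rewrite mulr_ge0.
pose q (x : T) := \sum_(k < n.+1) F k x.
have bq : bcont q by exact: bcont_sum.
pose Kq := \sum_(k < n.+1) g (k%:R * h).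
have qK (x : T) : `|q x| <= Kq.
  by apply: (le_trans (ler_norm_sum _ _ _)); exact: ler_sum.
pose u := time_integral (P := P) (Y := Y) h q.
have bu : bcont u by exact: (bcont_time_integral PY).
have bSq := bcont_semigroup PY h0' bq.
exists u, (fun x => S h q x - q x); split => //.
- exact: bcontB.
- exact: (time_integral_generator PY).
- move=> x; apply: (le_trans (time_integral_norm PY h0' bq qK x)).
  rewrite /Kq big_ord_recl mul0r mulrDr addrC; apply: lerD => //.
  exact: gJ.
move=> x; pose w (y : T) := h^-1 * u y - S h q y.
have wK (y : T) : `|w y| <= n.+1%:R * w0.
  rewrite -(ler_pM2l h0) -{1}(ger0_norm h0') -normrM mulrBr mulVKf ?gt_eqF //.
  apply: (time_integral_close PY) => // t /andP[t0 th].
  rewrite !(semigroup_sum cY) // -sumrB.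
  apply: (le_trans (ler_norm_sum _ _ _)).
  apply: (@le_trans _ _ (\sum_(k < n.+1) w0)); last first.
    by rewrite sumr_const card_ord mulr_natl.
  apply: ler_sum => k _; apply: iter_split_step_orbit => // z.
  apply: (semigroup_equicontinuous PY bf de) => //.
  by rewrite distrC ger0_norm ?subr_ge0 // (le_lt_trans _ hd) // lerBlDr lerDl.
have uE : u = (fun y => h * (w y + S h q y)).
  by apply/funext => y; rewrite /w subrK mulVKf ?gt_eqF.
have stepq : S h q x + h * jump_gen (S h q) x = \sum_(k < n.+1) F k.+1 x.
  transitivity (split_step h q x).
    by rewrite /split_step semigroup_jump_step.
  transitivity (S h (fun y => \sum_(k < n.+1) jump_step h (F k) y) x).
    congr (S h _ x); apply/funext => y; rewrite /jump_step big_split /=.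
    congr (_ + _); rewrite -mulr_sumr; congr (_ * _).
    rewrite /jump_gen exchange_big; apply: eq_bigr => i _ /=.
    by rewrite -mulr_sumr -sumrB.
  by rewrite (semigroup_sum cY) // => k; exact: bcont_jump_step.
have -> : S h q x - q x + jump_gen u x + f x = F n.+1 x + h * jump_gen w x.
  rewrite {1}uE jump_genM jump_genD.
  have tele : \sum_(k < n.+1) F k.+1 x - q x + f x = F n.+1 x.
    rewrite big_ord_recr /q big_ord_recl /=.
    rewrite -[f x]/(F 0%N x); ring.
  rewrite -tele -stepq; ring.
apply: (le_trans (ler_normD _ _)); rewrite [e]splitr; apply: lerD.
  by apply: le_trans (FK _ _) _; rewrite hH.
rewrite normrM (ger0_norm h0').
apply: le_trans (ler_wpM2l h0' (jump_gen_norm wK x)) _.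
rewrite (_ : h * _ = 2 * total_jump_rate * H * w0); last by rewrite -hH; ring.
rewrite /w0 mulrCA; apply: ler_piMr; first exact: ltW.
by rewrite ler_pdivrMr // mul1r lerDl.
Qed.

End Solution.
End ApproximatePoisson.

Section SummableFamilies.
Context {R : realType} {I : choiceType} (a : I -> \bar R).
Hypothesis a_ge0 : forall i, (0 <= a i)%E.
Hypothesis a_fin : (\esum_(i in [set: I]) a i < +oo)%E.

Lemma esum_fin_num : (\esum_(i in [set: I]) a i)%E \is a fin_num.
Proof. by rewrite ge0_fin_numE //; exact: esum_ge0. Qed.

Lemma esum_term_fin i : a i \is a fin_num.
Proof.
rewrite ge0_fin_numE //; apply: le_lt_trans a_fin.
by apply: esum_ge; exists [set i]; [split|rewrite fsbig_set1].
Qed.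

Lemma sum_fine_seq (s : seq I) :
  (\sum_(i <- s) a i)%E = (\sum_(i <- s) fine (a i))%:E.
Proof. by rewrite -sumEFin; apply: eq_bigr => i _; rewrite fineK ?esum_term_fin. Qed.

Lemma sum_fine_le_esum (s : seq I) : uniq s ->
  \sum_(i <- s) fine (a i) <= fine (\esum_(i in [set: I]) a i)%E.
Proof.
move=> us; rewrite -lee_fin fineK ?esum_fin_num // -sum_fine_seq.
apply: esum_ge; exists [set` s]; first by split => //; exact: finite_seq.
by rewrite -fsbig_seq.
Qed.

Lemma esum_tail (e : R) : 0 < e -> exists s : seq I, uniq s /\
  forall s' : seq I, uniq s' -> (forall i, i \in s' -> i \notin s) ->
  \sum_(i <- s') fine (a i) <= e.
Proof.
move=> e0; have := esum_fin_num.
move=> /(ub_ereal_sup_adherent e0)[_ [X [finX _] <-]].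
rewrite fsbig_finite //= sum_fine_seq -/(esum _ _) => Xe.
have usX : uniq (finmap.enum_fset (fset_set X)) by exact: finmap.fset_uniq.
move: (finmap.enum_fset (fset_set X)) usX Xe => sX usX Xe.
exists sX; split => // s' us' s's.
have us : uniq (s' ++ sX).
  rewrite cat_uniq us' usX andbT /=.
  by apply/hasPn => i iX; apply/negP => /s's; rewrite iX.
have := sum_fine_le_esum us; rewrite big_cat /=.
move: Xe; rewrite -(fineK esum_fin_num) -EFinB lte_fin; lra.
Qed.

End SummableFamilies.

(** * Contraction of the environment under the coupling *)

Lemma ptws_cvg {I : eqType} {V : topologicalType}
    (F : set_system {ptws I -> V}) (f : {ptws I -> V}) : Filter F ->
  (forall i, (fun g : {ptws I -> V} => g i) @ F --> f i) -> F --> f.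
Proof.
move=> FF Ff; apply/cvg_sup => i; rewrite cvg_image; last first.
  by rewrite eqEsubset; split=> v // _; exists (cst v).
move=> W /Ff /= FW; rewrite nbhs_simpl; exists (@^~ i @^-1` W) => //.
by rewrite image_preimage // eqEsubset; split=> // v _; exists (fun=> v).
Qed.

Lemma mdist_lipschitz {R : realType} {M : metricType R} (a b a' b' : M) :
  `|mdist a b - mdist a' b'| <= mdist a a' + mdist b b'.
Proof.
have h1 := metric_triangle a a' b; have h2 := metric_triangle a' b' b.
have h3 := metric_triangle a' a b'; have h4 := metric_triangle a b b'.
have s1 := metric_sym a a'; have s2 := metric_sym b b'.
rewrite ler_norml; lra.
Qed.

Lemma mdist_continuous {R : realType} {M : metricType R} {T : topologicalType}
    (g1 g2 : T -> M) : continuous g1 -> continuous g2 ->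
  continuous (fun t => mdist (g1 t) (g2 t) : R).
Proof.
move=> c1 c2 p; apply/(@cvgrPdist_le R R) => e e0.
have e2 : 0 < e / 2 by rewrite divr_gt0.
have n1 : nbhs p [set q | ball (g1 p) (e / 2) (g1 q)] := c1 p _ (nbhsx_ballx (g1 p) _ e2).
have n2 : nbhs p [set q | ball (g2 p) (e / 2) (g2 q)] := c2 p _ (nbhsx_ballx (g2 p) _ e2).
have n12 := filterI n1 n2.
suff sub : [set q | ball (g1 p) (e / 2) (g1 q)] `&`
    [set q | ball (g2 p) (e / 2) (g2 q)] `<=`
    [set q | `|mdist (g1 p) (g2 p) - mdist (g1 q) (g2 q)| <= e].
  exact: (@filterS _ (nbhs p) (nbhs_filter p) _ _ sub (n12 (nbhs_filter p))).
move=> q [/=]; rewrite !ballEmdist /= => b1 b2.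
apply: (le_trans (mdist_lipschitz _ _ _ _)); lra.
Qed.

Section Configurations.
Context {R : realType} {d : nat} {E : pmetricType R}.
Notation Om := (Omega d E).

Lemma coordinate_continuous (x : Zd d) : continuous (fun eta : Om => eta x).
Proof. by move=> eta; exact: (@proj_continuous _ (fun=> E) x eta). Qed.

Lemma translate_continuous (x : Zd d) : continuous (@translate R d E x).
Proof.
move=> eta.
have H := @ptws_cvg (Zd d) E (@translate R d E x @ nbhs (eta : Om)).
have := H (@translate R d E x eta).
have FF : Filter (@translate R d E x @ nbhs (eta : Om)) by typeclasses eauto.
move=> /(_ FF); apply => y.
exact: (@coordinate_continuous (y - x) eta).
Qed.

Lemma translate0 (eta : Om) : translate 0 eta = eta.
Proof. by apply/funext => y; rewrite /translate subr0. Qed.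

Lemma translateD (x y : Zd d) (eta : Om) :
  translate x (translate y eta) = translate (x + y) eta.
Proof. by apply/funext => z; rewrite /translate opprD addrA. Qed.

Lemma mdist_coordinate_continuous (x : Zd d) :
  continuous (fun p : Om * Om => mdist (p.1 x) (p.2 x)).
Proof.
have c1 : continuous (fun q : Om * Om => q.1 x).
  move=> p; apply: (@continuous_comp _ _ _ fst (fun eta : Om => eta x)).
    exact: cvg_fst.
  exact: coordinate_continuous.
have c2 : continuous (fun q : Om * Om => q.2 x).
  move=> p; apply: (@continuous_comp _ _ _ snd (fun eta : Om => eta x)).
    exact: cvg_snd.
  exact: coordinate_continuous.
exact: (@mdist_continuous R E (Om * Om)%type _ _ c1 c2).
Qed.

End Configurations.

Section LawTransfer.
Context {R : realType} {T : ptopologicalType}.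
Context {d1 d2 : measure_display} {W1 : measurableType d1} {W2 : measurableType d2}.
Context (Q1 : probability W1 R) (Q2 : probability W2 R).
Context (X1 : W1 -> T) (X2 : W2 -> T).
Hypothesis mX1 : measurable_fun setT (X1 : W1 -> borel T).
Hypothesis mX2 : measurable_fun setT (X2 : W2 -> borel T).
Hypothesis X12 : forall A : set (borel T), measurable A ->
  Q1 (X1 @^-1` A) = Q2 (X2 @^-1` A).

Lemma same_law_ge0_integral (f : borel T -> \bar R) :
  measurable_fun setT f -> (forall x, 0 <= f x)%E ->
  (\int[Q1]_w f (X1 w) = \int[Q2]_w f (X2 w))%E.
Proof.
move=> mf f0.
have := @ge0_integral_pushforward _ _ W1 (borel T) R X1 mX1 Q1 setT f
  measurableT mf (fun x _ => f0 x).
have := @ge0_integral_pushforward _ _ W2 (borel T) R X2 mX2 Q2 setT f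
  measurableT mf (fun x _ => f0 x).
rewrite !preimage_setT /= => <- <-.
by apply: eq_measure_integral => A mA _; exact: X12.
Qed.

Lemma same_law_Rintegral (f : T -> R) (K : R) : continuous f ->
  (forall x, `|f x| <= K) ->
  \int[Q1]_w f (X1 w) = \int[Q2]_w f (X2 w).
Proof.
move=> cf fK; have mf := continuous_measurable_real cf.
have mfX1 : measurable_fun setT (f \o X1) by exact: (measurableT_comp mf).
have mfX2 : measurable_fun setT (f \o X2) by exact: (measurableT_comp mf).
have i1 : Q1.-integrable setT (EFin \o (f \o X1)).
  apply: (@bounded_integrable _ _ _ _ _ _ K) => //; last by move=> x _; exact: fK.
  exact: probability_lty.
have i2 : Q2.-integrable setT (EFin \o (f \o X2)).
  apply: (@bounded_integrable _ _ _ _ _ _ K) => //; last by move=> x _; exact: fK.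
  exact: probability_lty.
have mEf : measurable_fun setT (EFin \o f : borel T -> \bar R).
  exact/measurable_EFinP.
rewrite /Rintegral integralE [in RHS]integralE; congr (fine (_ - _)).
  rewrite -[LHS](eq_integral _ (fun w => ((EFin \o f)^\+ (X1 w))%E)); last first.
    by move=> w _; rewrite !funeposE.
  rewrite -[RHS](eq_integral _ (fun w => ((EFin \o f)^\+ (X2 w))%E)); last first.
    by move=> w _; rewrite !funeposE.
  exact: (same_law_ge0_integral (measurable_funepos mEf) (funepos_ge0 _)).
rewrite -[LHS](eq_integral _ (fun w => ((EFin \o f)^\- (X1 w))%E)); last first.
  by move=> w _; rewrite !funenegE.
rewrite -[RHS](eq_integral _ (fun w => ((EFin \o f)^\- (X2 w))%E)); last first.
  by move=> w _; rewrite !funenegE.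
exact: (same_law_ge0_integral (measurable_funeneg mEf) (funeneg_ge0 _)).
Qed.

End LawTransfer.

Section LipschitzFunctions.
Context {R : realType} {d : nat} {E : pmetricType R}.
Notation Om := (Omega d E).
Implicit Types (f : Om -> R) (s : seq (Zd d)) (eta xi : Om).

Definition replace s eta xi : Om := fun y => if y \in s then xi y else eta y.

Lemma delta_ge0 f x : (0 <= delta f x)%E.
Proof. by rewrite /delta le_max lexx. Qed.

Context (f : Om -> R).
Hypothesis f_fin : (triple_norm f < +oo)%E.

Lemma delta_fin x : delta f x \is a fin_num.
Proof. exact: (esum_term_fin (delta_ge0 f) f_fin). Qed.

Lemma delta_lipschitz eta xi x : (forall y, y <> x -> eta y = xi y) ->
  f eta - f xi <= fine (delta f x) * mdist (eta x) (xi x).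
Proof.
move=> ex; have [exx|exx] := eqVneq (eta x) (xi x).
  have -> : eta = xi.
    by apply/funext => y; have [->//|/eqP/ex] := eqVneq y x.
  by rewrite subrr mulr_ge0 ?mdist_ge0 // fine_ge0 // delta_ge0.
rewrite -ler_pdivrMr ?mdist_gt0 // -lee_fin fineK ?delta_fin // le_max.
apply/orP; right; apply: ereal_sup_ubound; exists (eta, xi) => //=.
by split => //; exact/eqP.
Qed.

Lemma replace_lipschitz s eta xi : uniq s ->
  `|f eta - f (replace s eta xi)| <=
  \sum_(x <- s) fine (delta f x) * mdist (eta x) (xi x).
Proof.
elim: s => [|x s IH] /=.
  move=> _; rewrite big_nil (_ : replace [::] eta xi = eta) ?subrr ?normr0 //.
move=> /andP[xs us]; rewrite big_cons [leRHS]addrC.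
rewrite -(subrKA (f (replace s eta xi))).
apply: (le_trans (ler_normD _ _)); apply: lerD; first exact: IH.
have rs : replace s eta xi x = eta x by rewrite /replace (negbTE xs).
have rxs : replace (x :: s) eta xi x = xi x by rewrite /replace mem_head.
have ro y : y <> x -> replace s eta xi y = replace (x :: s) eta xi y.
  by move=> /eqP/negbTE yx; rewrite /replace inE yx.
have := delta_lipschitz ro.
have ro' y : y <> x -> replace (x :: s) eta xi y = replace s eta xi y.
  by move=> /ro.
have := delta_lipschitz ro'.
by rewrite rs rxs (metric_sym (xi x)) ler_norml; lra.
Qed.

Lemma replace_cvg s eta xi :
  replace (undup (s ++ pmap (@unpickle (Zd d)) (iota 0 n))) eta xi
    @[n --> \oo] --> xi.
Proof.
pose r n := replace (undup (s ++ pmap (@unpickle (Zd d)) (iota 0 n))) eta xi.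
apply: (@ptws_cvg (Zd d) E (r @ \oo) xi) => x.
have rx : \forall n \near \oo, r n x = xi x.
  exists (pickle x).+1 => // n /= xn; rewrite /r /replace mem_undup mem_cat.
  rewrite (_ : x \in pmap _ _ = true) ?orbT //.
  rewrite mem_pmap; apply/mapP; exists (pickle x); last by rewrite pickleK.
  by rewrite mem_iota add0n.
have h : (fun n => r n x) @ \oo --> xi x by exact: cvg_near_cst.
exact: h.
Qed.

Hypothesis f_cont : continuous f.
Hypothesis rho_le1 : forall a b : E, mdist a b <= 1.

Lemma finite_lipschitz (e : R) : 0 < e -> exists s, uniq s /\
  forall eta xi, `|f eta - f xi| <=
    \sum_(x <- s) fine (delta f x) * mdist (eta x) (xi x) + e.
Proof.
move=> e0; have e2 : 0 < e / 2 by rewrite divr_gt0.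
have [s [us ts]] := esum_tail (delta_ge0 f) f_fin e2.
exists s; split => // eta xi.
have fxi : f @ nbhs xi --> f xi by exact: f_cont.
have := cvg_comp _ _ (@replace_cvg s eta xi) fxi.
move=> /(@cvgrPdist_le R R)/(_ _ e2)[n _ /(_ n (leqnn n))] /=.
set s' := undup _ => fs'.
have us' : uniq s' by exact: undup_uniq.
have ss' (x : Zd d) : x \in s -> x \in s' by move=> xs; rewrite mem_undup mem_cat xs.
have := replace_lipschitz eta xi us'.
pose rest := [seq x <- s' | x \notin s].
have ur : uniq rest by rewrite filter_uniq.
have -> : \sum_(x <- s') fine (delta f x) * mdist (eta x) (xi x) =
    \sum_(x <- s) fine (delta f x) * mdist (eta x) (xi x) +
    \sum_(x <- rest) fine (delta f x) * mdist (eta x) (xi x).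
  rewrite -big_cat; apply: perm_big; apply: uniq_perm => // [|x].
    rewrite cat_uniq us ur andbT; apply/hasPn => x.
    by rewrite mem_filter => /andP[].
  rewrite mem_cat mem_filter; case xs : (x \in s) => //=.
  exact: ss'.
have : \sum_(x <- rest) fine (delta f x) * mdist (eta x) (xi x) <= e / 2.
  apply: (@le_trans _ _ (\sum_(x <- rest) fine (delta f x))).
    apply: ler_sum => x _; apply: ler_piMr => //.
    by rewrite fine_ge0 // delta_ge0.
  by apply: ts => // x; rewrite mem_filter => /andP[].
have := ler_normD (f eta - f (replace s' eta xi)) (f (replace s' eta xi) - f xi).
rewrite subrKA (distrC (f (replace s' eta xi))); lra.
Qed.

Lemma delta_sum_le s : uniq s ->
  \sum_(x <- s) fine (delta f x) <= fine (triple_norm f).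
Proof. exact: (sum_fine_le_esum (delta_ge0 f) f_fin). Qed.

Lemma triple_norm_osc eta xi : `|f eta - f xi| <= fine (triple_norm f).
Proof.
apply/ler_addgt0Pr => e e0; have [s [us fs]] := finite_lipschitz e0.
apply: (le_trans (fs eta xi)); rewrite lerD2r.
apply: le_trans (delta_sum_le us); apply: ler_sum => x _.
by apply: ler_piMr => //; rewrite fine_ge0 // delta_ge0.
Qed.

End LipschitzFunctions.

Lemma bcont_fst {R : realType} {T1 T2 : ptopologicalType} (f : T1 -> R) :
  bcont f -> bcont (fun p : T1 * T2 => f p.1).
Proof.
move=> [cf [K fK]]; split; last by exists K.
move=> p; apply: (@continuous_comp _ _ _ fst f); first exact: cvg_fst.
exact: cf.
Qed.

Lemma bcont_snd {R : realType} {T1 T2 : ptopologicalType} (f : T2 -> R) :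
  bcont f -> bcont (fun p : T1 * T2 => f p.2).
Proof.
move=> [cf [K fK]]; split; last by exists K.
move=> p; apply: (@continuous_comp _ _ _ snd f); first exact: cvg_snd.
exact: cf.
Qed.

Lemma continuous_measurable_EFin {R : realType} {T : ptopologicalType}
    (f : T -> R) : continuous f ->
  measurable_fun setT ((fun x => (f x)%:E) : borel T -> \bar R).
Proof.
move=> cf; apply/measurable_EFinP.
exact: continuous_measurable_real.
Qed.

Lemma measurable_continuous_comp {d : measure_display} {W : measurableType d}
    {T U : ptopologicalType} (g : T -> U) (f : W -> T) :
  continuous g -> measurable_fun setT (f : W -> borel T) ->
  measurable_fun setT (fun w => g (f w) : borel U).
Proof.
move=> cg mf _ A mA; have := continuous_measurable_borel cg measurableT mA.
by rewrite setTI => mgA; have := mf measurableT _ mgA; rewrite !setTI.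
Qed.

Lemma continuous_pair {T U V : topologicalType} (f : T -> U) (g : T -> V) :
  continuous f -> continuous g -> continuous (fun t => (f t, g t)).
Proof. by move=> cf cg t; apply: cvg_pair; [exact: cf|exact: cg]. Qed.

Section Coupling.
Context {R : realType} {d : nat} {E : pmetricType R}.
Notation Om := (Omega d E).
Hypothesis rho_le1 : forall a b : E, mdist a b <= 1.
Context {dW dV : measure_display} {W : measurableType dW} {V : measurableType dV}.
Context {P : Om -> probability W R} {Y : R -> W -> Om}.
Context {Phat : Om * Om -> probability V R} {Z : R -> V -> Om * Om}.
Hypothesis cY : cadlag_process Y.
Hypothesis PZ : strong_markov_coupling P Y Phat Z.
Hypothesis shiftZ : coupling_translation_invariant Phat Z.
Local Notation S := (semigroup P Y).
Local Notation Sh := (semigroup Phat Z).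
Let cZ := strong_markov_cadlag PZ.1.

Definition coupling_distance (t : R) : \bar R :=
  ereal_sup [set (\int[Phat p]_w (mdist ((Z t w).1 0) ((Z t w).2 0))%:E)%E
            | p in [set: Om * Om]].

Lemma bcont_mdist (x : Zd d) : bcont (fun p : Om * Om => mdist (p.1 x) (p.2 x)).
Proof.
split; first exact: mdist_coordinate_continuous.
by exists 1 => p; rewrite ger0_norm ?mdist_ge0.
Qed.

Lemma path_event_at (t : R) (A : set (borel Om)) : 0 <= t -> measurable A ->
  path_event [set y : R -> Om | A (y t)].
Proof. by move=> t0 mA; apply: sub_sigma_algebra; exists t, A. Qed.

Lemma coupling_fst t (f : Om -> R) eta xi : 0 <= t -> bcont f ->
  Sh t (fun p => f p.1) (eta, xi) = S t f eta.
Proof.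
move=> t0 [cf [K fK]].
have mZ := process_measurable cZ t0.
apply: (@same_law_Rintegral R Om _ _ V W (Phat (eta, xi)) (P eta)
  (fun w => (Z t w).1) (Y t) _ _ _ f K) => //.
- apply: (@measurable_continuous_comp _ V (Om * Om)%type Om fst (Z t) _ mZ).
  by move=> p; exact: cvg_fst.
- exact: (process_measurable cY t0).
- by move=> A mA; have [-> _] := PZ.2 eta xi _ (path_event_at t0 mA).
Qed.

Lemma coupling_snd t (f : Om -> R) eta xi : 0 <= t -> bcont f ->
  Sh t (fun p => f p.2) (eta, xi) = S t f xi.
Proof.
move=> t0 [cf [K fK]].
have mZ := process_measurable cZ t0.
apply: (@same_law_Rintegral R Om _ _ V W (Phat (eta, xi)) (P xi)
  (fun w => (Z t w).2) (Y t) _ _ _ f K) => //.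
- apply: (@measurable_continuous_comp _ V (Om * Om)%type Om snd (Z t) _ mZ).
  by move=> p; exact: cvg_snd.
- exact: (process_measurable cY t0).
- by move=> A mA; have [_ ->] := PZ.2 eta xi _ (path_event_at t0 mA).
Qed.

Lemma coupling_distance_ge0 t : (0 <= coupling_distance t)%E.
Proof.
apply: (@le_trans _ _ (\int[Phat point]_w (mdist ((Z t w).1 0) ((Z t w).2 0))%:E)%E).
  by apply: integral_ge0 => w _; rewrite lee_fin mdist_ge0.
by apply: ereal_sup_ubound; exists point.
Qed.

Lemma coupling_distance_le1 t : (coupling_distance t <= 1)%E.
Proof.
apply: ge_ereal_sup => _ [p _ <-].
apply: (@le_trans _ _ (\int[Phat p]_w 1)%E).
  by apply: le_integral_nonmeasurable => w _; rewrite lee_fin.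
by rewrite integral_cst // mul1e; exact: probability_le1.
Qed.

Lemma coupling_distance_coordinate (t : R) (x : Zd d) p (b : R) : 0 <= t ->
  (coupling_distance t <= b%:E)%E ->
  Sh t (fun p => mdist (p.1 x) (p.2 x)) p <= b.
Proof.
case: p => eta xi t0 tb.
pose tr (p : Om * Om) : Om * Om := (translate (- x) p.1, translate (- x) p.2).
have ctr : continuous tr.
  have c1 : continuous (fun p : Om * Om => translate (- x) p.1).
    move=> p; apply: (@continuous_comp _ _ _ fst (@translate R d E (- x))).
      exact: cvg_fst.
    exact: translate_continuous.
  have c2 : continuous (fun p : Om * Om => translate (- x) p.2).
    move=> p; apply: (@continuous_comp _ _ _ snd (@translate R d E (- x))).
      exact: cvg_snd.
    exact: translate_continuous.
  exact: (@continuous_pair (Om * Om)%type Om Om _ _ c1 c2).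
have mZ := process_measurable cZ t0.
pose F (p : borel (Om * Om)%type) : \bar R := (mdist (p.1 0) (p.2 0))%:E.
have mF : measurable_fun setT F.
  exact: (@continuous_measurable_EFin R (Om * Om)%type _ (bcont_mdist 0).1).
have F0 p : (0 <= F p)%E by rewrite lee_fin mdist_ge0.
have mtr : measurable_fun setT (fun w => tr (Z t w) : borel (Om * Om)%type).
  exact: (@measurable_continuous_comp _ V (Om * Om)%type (Om * Om)%type tr (Z t) ctr mZ).
have law (A : set (borel (Om * Om)%type)) : measurable A ->
    Phat (eta, xi) ((fun w => tr (Z t w)) @^-1` A) =
    Phat (tr (eta, xi)) (Z t @^-1` A).
  by move=> mA; exact: (@shiftZ (- x) eta xi t A t0 mA).
have HF := @same_law_ge0_integral R (Om * Om)%type _ _ V V (Phat (eta, xi))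
  (Phat (tr (eta, xi))) (fun w => tr (Z t w)) (Z t) mtr mZ law F mF F0.
have FE w : F (tr (Z t w)) = (mdist ((Z t w).1 x) ((Z t w).2 x))%:E.
  by rewrite /F /tr /translate /= opprK add0r.
have Fb : (\int[Phat (tr (eta, xi))]_w F (Z t w) <= b%:E)%E.
  apply: le_trans tb; apply: ereal_sup_ubound.
  by exists (tr (eta, xi)).
have Fge : (0 <= \int[Phat (tr (eta, xi))]_w F (Z t w))%E.
  by apply: integral_ge0 => w _; exact: F0.
rewrite /semigroup /Rintegral -lee_fin.
have -> : (\int[Phat (eta, xi)]_w (mdist ((Z t w).1 x) ((Z t w).2 x))%:E)%E =
    (\int[Phat (tr (eta, xi))]_w F (Z t w))%E.
  by rewrite -HF; apply: eq_integral => w _; rewrite FE.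
rewrite fineK // ge0_fin_numE //.
exact: (le_lt_trans Fb (ltry b)).
Qed.

Section Contraction.
Context (f : Om -> R) (t b : R).
Hypothesis f_cont : continuous f.
Hypothesis f_fin : (triple_norm f < +oo)%E.
Hypothesis t0 : 0 <= t.
Hypothesis tb : (coupling_distance t <= b%:E)%E.

Lemma bcont_triple_norm : bcont f.
Proof.
split => //; exists (fine (triple_norm f) + `|f point|) => x.
rewrite -[f x](subrK (f point)); apply: (le_trans (ler_normD _ _)).
by rewrite lerD2r; exact: triple_norm_osc.
Qed.

Lemma semigroup_osc eta xi :
  `|S t f eta - S t f xi| <= fine (triple_norm f) * b.
Proof.
have bf := bcont_triple_norm.
have b1 := @bcont_fst R Om Om f bf; have b2 := @bcont_snd R Om Om f bf.
apply/ler_addgt0Pr => e e0; have [s [us fs]] := finite_lipschitz f_fin f_cont rho_le1 e0.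
have b0 : 0 <= b by rewrite -lee_fin; exact: le_trans (coupling_distance_ge0 t) tb.
have bD (x : Zd d) := bcontM (fine (delta f x)) (bcont_mdist x).
pose G (p : Om * Om) := \sum_(x <- s) fine (delta f x) * mdist (p.1 x) (p.2 x).
have bG : bcont G by exact: bcont_sum.
have bGe : bcont (fun p => G p + e) by apply: bcontD => //; exact: bcont_cst.
have bd : bcont (fun p : Om * Om => f p.1 - f p.2) by exact: bcontB.
rewrite -(coupling_fst eta xi t0 bf) -(coupling_snd eta xi t0 bf).
rewrite -(semigroupB cZ) //.
have GE : Sh t (fun p => G p + e) (eta, xi) <= fine (triple_norm f) * b + e.
  rewrite (semigroupD cZ) //; last exact: bcont_cst.
  rewrite (semigroup_cst t e) lerD2r (semigroup_sum cZ) //.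
  apply: (@le_trans _ _ (\sum_(x <- s) fine (delta f x) * b)).
    apply: ler_sum => x _; rewrite (semigroupM cZ) //; last exact: bcont_mdist.
    rewrite ler_wpM2l ?fine_ge0 ?delta_ge0 //.
    exact: coupling_distance_coordinate.
  by rewrite -mulr_suml ler_wpM2r // delta_sum_le.
apply: le_trans GE; rewrite ler_norml.
apply/andP; split.
  rewrite -mulN1r -(semigroupM cZ) //; apply: (semigroup_le cZ) => //.
    exact: bcontM.
  move=> [x y] /=; have := fs x y.
  by rewrite mulN1r ler_norml => /andP[].
apply: (semigroup_le cZ) => // -[x y] /=; have := fs x y.
by rewrite ler_norml => /andP[].
Qed.

End Contraction.


Lemma stationary_osc (mu : probability (borel Om) R) (f : Om -> R) (t K : R) :
  stationary P Y mu -> 0 <= t -> continuous f ->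
  (forall eta xi, `|S t f eta - S t f xi| <= K) ->
  forall eta, `|S t f eta - \int[mu]_x f x| <= K.
Proof.
move=> st t0 cf osc eta; rewrite -(st t f t0 cf) ler_distlC.
apply: probability_Rintegral_between => xi.
by rewrite -ler_distlC.
Qed.

End Coupling.

Section Majorant.
Context {R : realType} {T : ptopologicalType}.
Context {dW : measure_display} {W : measurableType dW}.
Context {P : T -> probability W R} {Y : R -> W -> T}.
Hypothesis PY : feller_process P Y.
Local Notation S := (semigroup P Y).
Local Notation leb := (@lebesgue_measure R).
Context (f : T -> R) (a : R -> \bar R) (k : R) (n : nat).
Hypothesis bf : bcont f.
Hypothesis k_gt0 : 0 < k.
Hypothesis a_ge0 : forall t, (0 <= a t)%E.
Hypothesis a_le1 : forall t, (a t <= 1)%E.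
Hypothesis fa : forall (t : R) x, 0 <= t -> (`|S t f x|%:E <= k%:E * a t)%E.
Let J := (\int[leb]_(t in `[0%R, +oo[) ((t ^+ n)%:E * a t))%E.
Hypothesis a_int : (J < +oo)%E.

Definition sup_orbit (t : R) : R := sup [set `|S `|t| f x| | x in [set: T]].

Lemma orbit_norm_le (t : R) x : `|S `|t| f x| <= k.
Proof.
rewrite -lee_fin; apply: le_trans (fa x (normr_ge0 t)) _.
by rewrite -[leRHS]mule1; apply: lee_wpmul2l => //; rewrite lee_fin ltW.
Qed.

Lemma sup_orbit_ge (t : R) x : `|S `|t| f x| <= sup_orbit t.
Proof.
apply: ub_le_sup; last by exists x.
by exists k => _ [y _ <-]; exact: orbit_norm_le.
Qed.

Lemma sup_orbit_le (t c : R) : (forall x, `|S `|t| f x| <= c) -> sup_orbit t <= c.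
Proof.
move=> tc; apply: ge_sup; first by exists `|S `|t| f point|; exists point.
by move=> _ [x _ <-].
Qed.

Lemma sup_orbit_ge0 t : 0 <= sup_orbit t.
Proof. exact: le_trans (normr_ge0 _) (sup_orbit_ge t point). Qed.

Lemma sup_orbit_noninc (s t : R) : 0 <= s -> s <= t -> sup_orbit t <= sup_orbit s.
Proof.
move=> s0 st; have t0 := le_trans s0 st.
apply: sup_orbit_le => x; rewrite (ger0_norm t0) -(subrK s t).
rewrite (semigroup_comp PY) ?subr_ge0 //; apply: semigroup_norm => y.
by rewrite -{1}(ger0_norm s0) sup_orbit_ge.
Qed.

Lemma sup_orbit_uequicont : uequicont sup_orbit.
Proof.
move=> e e0; have [d d0 de] := orbit_equicontinuous PY bf e0.
exists d => //.
have key s t : `|s - t| < d -> sup_orbit s <= sup_orbit t + e.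
  move=> st; apply: sup_orbit_le => x.
  have := de x s t st; have := sup_orbit_ge t x.
  have := ler_normD (S `|t| f x) (S `|s| f x - S `|t| f x).
  rewrite subrKC; lra.
move=> s t st; rewrite ler_distl lerBlDr; apply/andP; split; apply: key => //.
by rewrite distrC.
Qed.

Lemma sup_orbit_kernel t : 0 <= t -> ((k^-1 * sup_orbit t)%:E <= a t)%E.
Proof.
move=> t0; have at_fin : a t \is a fin_num.
  by rewrite ge0_fin_numE //; apply: le_lt_trans (a_le1 t) (ltry 1).
rewrite -(fineK at_fin) lee_fin ler_pdivrMl //.
apply: sup_orbit_le => x; rewrite (ger0_norm t0) -lee_fin EFinM fineK //.
exact: fa.
Qed.

Lemma sup_orbit_sum (h : R) (m : nat) : 0 <= h ->
  h * \sum_(i < m) sup_orbit (i.+1%:R * h) <= \int[leb]_(t in `[0, m%:R * h]) sup_orbit t.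
Proof.
move=> h0; have cq := uequicont_continuous sup_orbit_uequicont.
elim: m => [|m IH].
  by rewrite big_ord0 mulr0 mul0r set_itv1 Rintegral_set1.
have mh0 : 0 <= m%:R * h by rewrite mulr_ge0.
have mh1 : m%:R * h <= m.+1%:R * h by rewrite ler_wpM2r // ler_nat.
rewrite big_ord_recr /= mulrDr (Rintegral_itv_cat cq mh0 mh1).
apply: lerD => //.
have -> : h * sup_orbit (m.+1%:R * h) =
    \int[leb]_(t in `[m%:R * h, m.+1%:R * h]) sup_orbit (m.+1%:R * h).
  by rewrite Rintegral_itv_cst // -mulrBl -natr1 addrAC subrr add0r mul1r.
apply: le_Rintegral => //.
- by apply: continuous_itv_integrable => ?; exact: cst_continuous.
- exact: continuous_itv_integrable.
- move=> t; rewrite /= in_itv /= => /andP[t1 t2].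
  by apply: sup_orbit_noninc => //; exact: le_trans t1.
Qed.

Lemma sup_orbit_integral (M : R) : 1 <= M ->
  \int[leb]_(t in `[0, M]) sup_orbit t <= k * (1 + fine J).
Proof.
move=> M1; have cq := uequicont_continuous sup_orbit_uequicont.
rewrite (Rintegral_itv_cat cq ler01 M1) mulrDr mulr1; apply: lerD.
  have -> : k = \int[leb]_(t in `[0, 1]) k by rewrite Rintegral_itv_cst // subr0 mul1r.
  apply: le_Rintegral => //.
  - exact: continuous_itv_integrable.
  - by apply: continuous_itv_integrable => ?; exact: cst_continuous.
  - by move=> t _; apply: sup_orbit_le => x; exact: orbit_norm_le.
rewrite -ler_pdivrMl // -RintegralZl //; last exact: continuous_itv_integrable.
have J0 : (0 <= J)%E.
  apply: integral_ge0 => t; rewrite /= in_itv /= andbT => t0.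
  by rewrite mule_ge0 // lee_fin exprn_ge0.
have Jfin : J \is a fin_num by rewrite ge0_fin_numE.
have IJ : (\int[leb]_(t in `[1%R, M]) (k^-1 * sup_orbit t)%:E <= J)%E.
  rewrite /J integral_mkcond [leRHS]integral_mkcond.
  apply: le_integral_nonmeasurable => t _; rewrite !patchE !mem_setE !in_itv /= andbT.
  case: ifPn => [/andP[t1 t2]|_]; last first.
    by case: ifPn => // t0; rewrite mule_ge0 // lee_fin exprn_ge0.
  have t0 : 0 <= t by exact: le_trans t1.
  rewrite t0; apply: le_trans (sup_orbit_kernel t0) _.
  rewrite -[leLHS]mul1e; apply: lee_wpmul2r => //.
  by rewrite lee_fin exprn_ege1.
rewrite /Rintegral fine_le //.
rewrite ge0_fin_numE; first exact: le_lt_trans IJ a_int.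
apply: integral_ge0 => t _; rewrite lee_fin mulr_ge0 ?sup_orbit_ge0 //.
by rewrite invr_ge0 ltW.
Qed.

Lemma sup_orbit_riemann (h : R) (m : nat) : 0 <= h ->
  h * \sum_(i < m) sup_orbit (i.+1%:R * h) <= k * (1 + fine J).
Proof.
move=> h0; apply: le_trans (sup_orbit_sum m h0) _.
have mh0 : 0 <= m%:R * h by rewrite mulr_ge0.
have M1 : 1 <= m%:R * h + 1 by rewrite lerDr.
apply: le_trans (sup_orbit_integral M1).
have cq := uequicont_continuous sup_orbit_uequicont.
rewrite (Rintegral_itv_cat cq mh0 (_ : m%:R * h <= m%:R * h + 1)) ?lerDl //.
by apply: Rintegral_ge0 => t _; exact: sup_orbit_ge0.
Qed.

End Majorant.

Section Shift.
Context {R : realType} {d : nat} {E : pmetricType R}.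
Notation Om := (Omega d E).
Context {dW : measure_display} {W : measurableType dW}.
Context {P : Om -> probability W R} {Y : R -> W -> Om}.
Hypothesis cY : cadlag_process Y.
Hypothesis shiftY : translation_invariant P Y.

Lemma semigroup_translate (x : Zd d) (t : R) (g : Om -> R) (eta : Om) :
  0 <= t -> bcont g ->
  semigroup P Y t (fun y => g (translate x y)) eta =
  semigroup P Y t g (translate x eta).
Proof.
move=> t0 [cg [K gK]].
have mY := process_measurable cY t0.
have mtY : measurable_fun setT (fun w => translate x (Y t w) : borel Om).
  exact: (@measurable_continuous_comp _ W Om Om (@translate R d E x) (Y t)
    (@translate_continuous R d E x) mY).
have law (A : set (borel Om)) : measurable A ->
    P eta ((fun w => translate x (Y t w)) @^-1` A) =
    P (translate x eta) (Y t @^-1` A).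
  by move=> mA; exact: (@shiftY x eta t A t0 mA).
exact: (@same_law_Rintegral R Om _ _ W W (P eta) (P (translate x eta))
  (fun w => translate x (Y t w)) (Y t) mtY mY law g K cg gK).
Qed.

End Shift.

(** * Jump rates *)

Section FamilySums.
Context {R : realType} {d : nat}.
Implicit Types (f p : Zd d -> R) (s B : seq (Zd d)).

Definition tail_bound B f (e : R) : Prop :=
  forall s, uniq s -> (forall z, z \in s -> z \notin B) -> \sum_(z <- s) f z <= e.

Lemma esum_real_tail p B e : (forall z, 0 <= p z) -> uniq B -> tail_bound B p e ->
  (\esum_(z in [set: Zd d]) (p z)%:E \is a fin_num)%E /\
  \sum_(z <- B) p z <= fine (\esum_(z in [set: Zd d]) (p z)%:E)%E
    <= \sum_(z <- B) p z + e.
Proof.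
move=> p0 uB tB; set S := (\esum_(z in _) _)%E.
have S0 : (0 <= S)%E by apply: esum_ge0 => z _; rewrite lee_fin.
have lS : ((\sum_(z <- B) p z)%:E <= S)%E.
  rewrite -sumEFin; apply: esum_ge; exists [set` B].
    by split => //; exact: finite_seq.
  by rewrite -fsbig_seq.
have Su : (S <= (\sum_(z <- B) p z + e)%:E)%E.
  apply: ge_ereal_sup => _ [X [finX _] <-]; rewrite fsbig_finite //= sumEFin lee_fin.
  have usX : uniq (finmap.enum_fset (fset_set X)) by exact: finmap.fset_uniq.
  move: (finmap.enum_fset (fset_set X)) usX => s us.
  rewrite (bigID (fun z => z \in B)) /=; apply: lerD.
    rewrite -big_filter [leRHS](bigID (fun z => z \in s)) /=.
    rewrite -[X in _ <= X + _]big_filter.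
    have -> : \sum_(z <- [seq z <- s | z \in B]) p z =
        \sum_(z <- [seq z <- B | z \in s]) p z.
      apply: perm_big; apply: uniq_perm; rewrite ?filter_uniq // => z.
      by rewrite !mem_filter andbC.
    by rewrite lerDl sumr_ge0.
  rewrite -big_filter; apply: tB; first by rewrite filter_uniq.
  by move=> z; rewrite mem_filter => /andP[].
have Sfin : S \is a fin_num by rewrite ge0_fin_numE //; apply: le_lt_trans Su (ltry _).
split => //; move: lS Su; rewrite -(fineK Sfin) !lee_fin => -> /=.
by [].
Qed.

Lemma sumZ_approx f B e : uniq B -> tail_bound B (fun z => `|f z|) e ->
  `|sumZ f - \sum_(z <- B) f z| <= e.
Proof.
move=> uB tB; pose p z := Num.max (f z) 0; pose m z := Num.max (- f z) 0.
have p0 z : 0 <= p z by rewrite le_max lexx orbT.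
have m0 z : 0 <= m z by rewrite le_max lexx orbT.
have pf z : p z <= `|f z| by rewrite ge_max ler_norm normr_ge0.
have mf z : m z <= `|f z| by rewrite ge_max -normrN ler_norm normr_ge0.
have pm z : f z = p z - m z.
  rewrite /p /m; case: (leP (f z) 0) => fz.
    by rewrite max_l ?oppr_ge0 // sub0r opprK.
  by rewrite max_r ?oppr_le0 ?ltW // subr0.
have tp : tail_bound B p e.
  by move=> s us sB; apply: le_trans (tB s us sB); apply: ler_sum.
have tm : tail_bound B m e.
  by move=> s us sB; apply: le_trans (tB s us sB); apply: ler_sum.
have [pfin /andP[p1 p2]] := esum_real_tail p0 uB tp.
have [mfin /andP[m1 m2]] := esum_real_tail m0 uB tm.
rewrite /sumZ fineB //.
rewrite (eq_bigr (fun z => p z - m z)) // sumrB.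
by rewrite ler_norml; lra.
Qed.

Lemma mx_norm_entry (x : 'rV[R]_d) i : `|x ord0 i| <= `|x|.
Proof.
rewrite /Num.norm /= mx_normrE.
exact: (le_bigmax _ (fun ij : 'I_1 * 'I_d => `|x ij.1 ij.2|) (ord0, i)).
Qed.

Lemma mx_norm_le (x : 'rV[R]_d) (c : R) : 0 <= c ->
  (forall i, `|x ord0 i| <= c) -> `|x| <= c.
Proof.
move=> c0 xc; rewrite /Num.norm /= mx_normrE; apply: bigmax_le => // -[a i] _ /=.
by rewrite (ord1 a).
Qed.

Lemma embed_entry (z : Zd d) i : `|(z ord0 i)%:~R : R| <= `|embed z : 'rV[R]_d|.
Proof. by have := mx_norm_entry (embed z) i; rewrite mxE. Qed.

Lemma embed_ge1 (z : Zd d) : z != 0 -> 1 <= `|embed z : 'rV[R]_d|.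
Proof.
move=> z0; have [i zi] : exists i, z ord0 i != 0.
  apply/existsP; rewrite -negb_forall; apply: contra z0 => /forallP z0.
  by apply/eqP/rowP => i; rewrite mxE; exact/eqP.
apply: le_trans (embed_entry z i).
by rewrite -intr_norm -[1]/(1%:~R) ler_int -gtz0_ge1 normr_gt0.
Qed.

End FamilySums.

Lemma triple_norm_subcst {R : realType} {d : nat} {E : pmetricType R}
    (f : Omega d E -> R) (c : Omega d E -> R) :
  (forall eta xi, c eta = c xi) ->
  triple_norm (fun eta => f eta - c eta) = triple_norm f.
Proof.
move=> cc; apply: eq_esum => x _; congr (maxe 0%E (ereal_sup _)).
have e (p : Omega d E * Omega d E) : (f p.1 - c p.1) - (f p.2 - c p.2) = f p.1 - f p.2.
  by rewrite (cc p.1 p.2); ring.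
by apply/seteqP; split => _ [p px <-]; exists p => //; rewrite e.
Qed.

Section Rates.
Context {R : realType} {d : nat} {E : pmetricType R}.
Notation Om := (Omega d E).
Context (alpha : Om -> Zd d -> R).
Hypothesis alphaP : admissible alpha.

Definition weighted_rate (z : Zd d) : \bar R :=
  (`|embed z|%:E * ereal_sup [set `|alpha eta z|%:E | eta in setT])%E.

Lemma weighted_rate_ge0 z : (0 <= weighted_rate z)%E.
Proof.
apply: mule_ge0; first by rewrite lee_fin.
apply: (@le_trans _ _ `|alpha point z|%:E); first by rewrite lee_fin.
by apply: ereal_sup_ubound; exists point.
Qed.

Lemma weighted_rate_fin z : weighted_rate z \is a fin_num.
Proof. exact: (esum_term_fin weighted_rate_ge0 (rate_norm1 alphaP)). Qed.

Lemma rate_le z eta : `|embed z : 'rV[R]_d| * alpha eta z <= fine (weighted_rate z).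
Proof.
rewrite -lee_fin fineK ?weighted_rate_fin // EFinM.
apply: lee_wpmul2l; first by rewrite lee_fin.
apply: (@le_trans _ _ `|alpha eta z|%:E); first by rewrite lee_fin ler_norm.
by apply: ereal_sup_ubound; exists eta.
Qed.

Lemma weighted_rate0 : fine (weighted_rate 0) = 0.
Proof.
rewrite /weighted_rate (_ : embed 0 = 0) ?normr0 ?mul0e //.
by apply/rowP => i; rewrite !mxE.
Qed.

Lemma rate_tail (e : R) : 0 < e -> exists B : seq (Zd d),
  [/\ uniq B, 0 \notin B & tail_bound B (fun z => fine (weighted_rate z)) e].
Proof.
move=> e0; have [s [us ts]] := esum_tail weighted_rate_ge0 (rate_norm1 alphaP) e0.
exists [seq z <- s | z != 0]; split; first by rewrite filter_uniq.
  by rewrite mem_filter eqxx.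
move=> s' us' s's; rewrite (bigID (fun z => z != 0)) /= addrC big1 ?add0r.
  rewrite -big_filter; apply: ts; first by rewrite filter_uniq.
  move=> z; rewrite mem_filter => /andP[z0 /s's].
  by rewrite mem_filter z0.
by move=> z /negPn/eqP ->; exact: weighted_rate0.
Qed.

Lemma rate_sum_le (s : seq (Zd d)) : uniq s ->
  \sum_(z <- s) fine (weighted_rate z) <=
  fine (\esum_(z in [set: Zd d]) weighted_rate z)%E.
Proof. exact: (sum_fine_le_esum weighted_rate_ge0 (rate_norm1 alphaP)). Qed.

Lemma sumZ_rates (h : Zd d -> R) (L e : R) B eta : 0 <= L ->
  uniq B -> tail_bound B (fun z => fine (weighted_rate z)) e ->
  (forall z, `|h z| <= L * `|embed z : 'rV[R]_d|) ->
  `|sumZ (fun z => alpha eta z * h z) - \sum_(z <- B) alpha eta z * h z| <= L * e.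
Proof.
move=> L0 uB tB hL; apply: sumZ_approx => // s us sB.
apply: (@le_trans _ _ (\sum_(z <- s) L * fine (weighted_rate z))).
  apply: ler_sum => z _; have a0 := rate_ge0 alphaP eta z.
  rewrite normrM (ger0_norm a0).
  apply: (@le_trans _ _ (alpha eta z * (L * `|embed z : 'rV[R]_d|))).
    exact: ler_wpM2l.
  by rewrite mulrCA ler_wpM2l // mulrC rate_le.
by rewrite -mulr_sumr ler_wpM2l // tB.
Qed.

Lemma bcont_rate z : z != 0 -> bcont (alpha ^~ z).
Proof.
move=> z0; split; first exact: (rate_continuous alphaP).
exists (fine (weighted_rate z)) => eta.
have a0 := rate_ge0 alphaP eta z; rewrite (ger0_norm a0).
apply: le_trans (rate_le z eta).
by rewrite -[leLHS]mul1r ler_wpM2r // embed_ge1.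
Qed.

Lemma triple_norm_ge0 (f : Om -> R) : (0 <= triple_norm f)%E.
Proof. by apply: esum_ge0 => x _; exact: delta_ge0. Qed.

Lemma rate_triple_norm_fin z : (triple_norm (alpha ^~ z) < +oo)%E.
Proof.
have := esum_term_fin (fun z => triple_norm_ge0 (alpha ^~ z)) (rate_triple_norm alphaP) z.
by rewrite ge0_fin_numE // triple_norm_ge0.
Qed.

Context (alpha0 : Om -> Zd d -> R) (c : R).
Hypothesis alpha0_cst : forall eta xi z, alpha0 eta z = alpha0 xi z.
Hypothesis alpha_c :
  (triple_norm1 (fun eta z => alpha eta z - alpha0 eta z)%R <= c%:E)%E.

Lemma weighted_triple_norm_sum (B : seq (Zd d)) : uniq B ->
  \sum_(z <- B) `|embed z : 'rV[R]_d| * fine (triple_norm (alpha ^~ z)) <= c.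
Proof.
move=> uB; rewrite -lee_fin; apply: le_trans alpha_c.
rewrite /triple_norm1 -sumEFin; apply: esum_ge; exists [set` B].
  by split => //; exact: finite_seq.
rewrite -fsbig_seq //; apply: lee_sum => z _.
have -> : triple_norm (fun eta => alpha eta z - alpha0 eta z) = triple_norm (alpha ^~ z).
  by apply: triple_norm_subcst => eta xi; exact: alpha0_cst.
by rewrite EFinM fineK // ge0_fin_numE ?triple_norm_ge0 // rate_triple_norm_fin.
Qed.

End Rates.

Section Corrector.
Context {R : realType} {d : nat} {E : pmetricType R}.
Notation Om := (Omega d E).
Hypothesis rho_le1 : forall a b : E, mdist a b <= 1.
Context {dW dV : measure_display} {W : measurableType dW} {V : measurableType dV}.
Context {P : Om -> probability W R} {Y : R -> W -> Om}.
Context {Phat : Om * Om -> probability V R} {Z : R -> V -> Om * Om}.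
Hypothesis PY : feller_process P Y.
Hypothesis shiftY : translation_invariant P Y.
Hypothesis PZ : strong_markov_coupling P Y Phat Z.
Hypothesis shiftZ : coupling_translation_invariant Phat Z.
Local Notation S := (semigroup P Y).
Local Notation leb := (@lebesgue_measure R).
Let cY := feller_cadlag PY.

Definition decay_integral : \bar R :=
  (\int[leb]_(t in `[0%R, +oo[) ((t ^+ d)%:E * coupling_distance (Phat := Phat) (Z := Z) t))%E.
Hypothesis decay : (decay_integral < +oo)%E.
Context (mu : probability (borel Om) R).
Hypothesis mu_st : stationary P Y mu.
Context (alpha alpha0 : Om -> Zd d -> R) (c : R).
Hypothesis alphaP : admissible alpha.
Hypothesis alpha0_cst : forall eta xi z, alpha0 eta z = alpha0 xi z.
Hypothesis alpha_c :
  (triple_norm1 (fun eta z => alpha eta z - alpha0 eta z)%R <= c%:E)%E.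
Context (B : seq (Zd d)) (i : 'I_d).
Hypothesis uB : uniq B.
Hypothesis B0 : 0 \notin B.

Definition partial_drift (eta : Om) : R :=
  \sum_(z <- B) (z ord0 i)%:~R * alpha eta z.

Let mB : R := \int[mu]_eta partial_drift eta.

Lemma bcont_partial_drift_term (z : Zd d) : bcont (fun eta => (z ord0 i)%:~R * alpha eta z).
Proof.
have [->|z0] := eqVneq z 0; last by apply: bcontM; exact: bcont_rate.
have -> : (fun eta => ((0 : Zd d) ord0 i)%:~R * alpha eta 0) = cst 0.
  by apply/funext => eta; rewrite mxE mul0r.
exact: bcont_cst.
Qed.

Lemma bcont_partial_drift : bcont partial_drift.
Proof. by apply: bcont_sum => z; exact: bcont_partial_drift_term. Qed.

Lemma partial_drift_osc (t : R) eta xi : 0 <= t ->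
  `|S t partial_drift eta - S t partial_drift xi| <=
  c * fine (coupling_distance (Phat := Phat) (Z := Z) t).
Proof.
move=> t0; set b := fine _.
have ab : (coupling_distance (Phat := Phat) (Z := Z) t <= b%:E)%E.
  rewrite fineK // ge0_fin_numE ?coupling_distance_ge0 //.
  exact: le_lt_trans (coupling_distance_le1 rho_le1 t) (ltry 1).
have b0 : 0 <= b by rewrite fine_ge0 // coupling_distance_ge0.
rewrite !(semigroup_sum cY) //; try exact: bcont_partial_drift_term.
rewrite -sumrB; apply: (le_trans (ler_norm_sum _ _ _)).
apply: (@le_trans _ _ (\sum_(z <- B)
    `|embed z : 'rV[R]_d| * fine (triple_norm (alpha ^~ z)) * b)); last first.
  rewrite -mulr_suml ler_wpM2r //.
  exact: (weighted_triple_norm_sum alphaP alpha0_cst alpha_c uB).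
rewrite !big_seq; apply: ler_sum => z zB.
have z0 : z != 0 by apply: contra B0 => /eqP <-.
have br := bcont_rate alphaP z0.
rewrite !(semigroupM cY) // -mulrBr normrM -mulrA.
apply: ler_pM => //; first exact: embed_entry.
apply: (@semigroup_osc R d E rho_le1 _ _ W V P Y Phat Z cY PZ shiftZ (alpha ^~ z) t b) => //.
  by case: br.
exact: (rate_triple_norm_fin alphaP).
Qed.

Lemma corrector (e : R) : 0 < e -> 0 <= c -> exists u Lu : Om -> R,
  [/\ bcont u, bcont Lu, generator P Y u Lu,
      forall eta, `|u eta| <= (c + e) * (1 + fine decay_integral) + e &
      forall eta, `|Lu eta
        + \sum_(z <- B) alpha point z * (u (translate (- z) eta) - u eta)
        + partial_drift eta - mB| <= e].
Proof.
move=> e0 c0; have k0 : 0 < c + e by rewrite ltr_wpDl.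
have bD := bcont_partial_drift.
pose f (eta : Om) := partial_drift eta - mB.
have bf : bcont f by apply: bcontB => //; exact: bcont_cst.
have a_ge0 := @coupling_distance_ge0 R d E _ V Phat Z.
have a_le1 := @coupling_distance_le1 R d E rho_le1 _ V Phat Z.
have fa (t : R) x : 0 <= t ->
    (`|S t f x|%:E <= (c + e)%:E * coupling_distance (Phat := Phat) (Z := Z) t)%E.
  move=> t0; rewrite -(@fineK _ (coupling_distance t)); last first.
    by rewrite ge0_fin_numE //; apply: le_lt_trans (a_le1 t) (ltry 1).
  rewrite -EFinM lee_fin (semigroupB cY) //; last exact: bcont_cst.
  rewrite (semigroup_cst t mB).
  apply: (@le_trans _ _ (c * fine (coupling_distance (Phat := Phat) (Z := Z) t))).
    apply: (stationary_osc mu_st t0 bD.1) => eta xi.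
    exact: partial_drift_osc.
  by rewrite ler_wpM2r ?fine_ge0 // lerDl ltW.
have fg (t : R) : 0 <= t -> forall x, `|S t f x| <= sup_orbit (P := P) (Y := Y) f t.
  move=> t0 x; have := sup_orbit_ge k0 a_le1 fa t x.
  by rewrite (ger0_norm t0).
have [u [Lu [bu bLu gu uU eq]]] := approximate_poisson PY B
  (a := fun z => alpha point z) (tau := fun z => translate (- z))
  (fun z => rate_ge0 alphaP point z)
  (fun z => @translate_continuous R d E (- z))
  (fun z t g x t0 bg => semigroup_translate cY shiftY (- z) x t0 bg)
  bf fg (fun s t s0 st => sup_orbit_noninc PY bf k0 a_le1 fa s0 st)
  (fun h n h0 => sup_orbit_riemann PY bf k0 a_ge0 a_le1 fa decay n h0) e0.
exists u, Lu; split => // eta.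
by have := eq eta; rewrite /f addrA.
Qed.

End Corrector.

(** * The walker *)

Section StepBound.
Context {R : realType} {dT : measure_display} {T : measurableType dT}.
Implicit Type mu : {measure set T -> \bar R}.

Lemma Rintegral_step_bound mu (D A : set T) (f : T -> R) (m a b : R) :
  measurable D -> (mu D < +oo)%E -> measurable A ->
  (forall x, D x -> `|f x - m| <= a + b * \1_A x) ->
  `|\int[mu]_(x in D) f x - m * fine (mu D)| <=
    a * fine (mu D) + b * fine (mu (A `&` D)).
Proof.
move=> mD muD mA fab.
have ic (c : R) : mu.-integrable D (EFin \o (fun=> c)).
  by apply: (@bounded_integrable _ _ _ _ _ _ `|c|).
have iA : mu.-integrable D (EFin \o (fun x => b * \1_A x)).
  apply: (@bounded_integrable _ _ _ _ _ _ `|b|) => //.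
    apply: measurable_funM => //; exact: measurable_indic.
  move=> x _; rewrite normrM ler_piMr // indicE.
  by case: (x \in A); rewrite ?normr1 ?normr0.
have iA0 : mu.-integrable D (EFin \o (\1_A : T -> R)).
  apply: (@bounded_integrable _ _ _ _ _ _ 1) => //.
  by move=> x _; rewrite indicE; case: (x \in A); rewrite ?normr1 ?normr0.
have iab (c : R) : mu.-integrable D (EFin \o (fun x => c + b * \1_A x)).
  by have := integrableD mD (ic c) iA.
have iba (c : R) : mu.-integrable D (EFin \o (fun x => c - b * \1_A x)).
  by have := integrableB mD (ic c) iA.
have RA : \int[mu]_(x in D) (b * \1_A x) = b * fine (mu (A `&` D)).
  by rewrite RintegralZl // /Rintegral integral_indic.
have Rab (c : R) : \int[mu]_(x in D) (c + b * \1_A x) =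
    c * fine (mu D) + b * fine (mu (A `&` D)).
  by rewrite RintegralD // RA Rintegral_cst.
have Rba (c : R) : \int[mu]_(x in D) (c - b * \1_A x) =
    c * fine (mu D) - b * fine (mu (A `&` D)).
  by rewrite RintegralB // RA Rintegral_cst.
have := @Rintegral_between _ _ _ mu D (fun x => m - a - b * \1_A x) f
  (fun x => m + a + b * \1_A x) mD (iba (m - a)) (iab (m + a)).
rewrite Rab Rba => /(_ _)/andP[].
  by move=> x /fab; rewrite ler_distl opprD !addrA.
by rewrite ler_norml; lra.
Qed.

End StepBound.

Section BadEvent.
Context {R : realType} {d : nat} {E : pmetricType R}.
Notation Om := (Omega d E).
Context {dW dV : measure_display} {W : measurableType dW} {V : measurableType dV}.
Context {P : Om -> probability W R} {Y : R -> W -> Om}.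
Context (Q : probability V R) (eta : R -> V -> Om) (X : R -> V -> Zd d).
Context (alpha : Om -> Zd d -> R) (eta0 : Om) (v : 'rV[R]_d).
Hypothesis walkerX : walker P Y Q eta X alpha eta0.
Hypothesis speedX : {ae Q, forall w, T^-1 *: embed (X T w) @[T --> +oo] --> v}.

Lemma walker_preimage (t : R) (A : Zd d -> Prop) : 0 <= t ->
  measurable [set w | A (X t w)].
Proof.
move=> t0.
have -> : [set w | A (X t w)] =
    \bigcup_(z in [set: Zd d]) (if `[< A z >] then X t @^-1` [set z] else set0).
  apply/seteqP; split => [w /= Aw|w [z _]].
    by exists (X t w) => //; rewrite asboolT.
  by case: asboolP => // Az /= ->.
apply: countable_bigcupT_measurable; first exact: countableP.
by move=> z; case: asboolP => // _; exact: (walker_measurable walkerX).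
Qed.

Context (i : 'I_d).
Let x (t : R) (w : V) : R := (X t w ord0 i)%:~R.

Let far (e t : R) (w : V) : Prop := e < `|t^-1 * x t w - v ord0 i|.

Let exceed (e : R) (n : nat) : set V :=
  \bigcup_(q : rat) (if n.+1%:R <= (ratr q : R) then [set w | far e (ratr q) w] else set0).

Lemma measurable_exceed e n : measurable (exceed e n).
Proof.
apply: bigcupT_measurable_rat => q; case: ifPn => // nq.
apply: (@walker_preimage _ (fun z => e < `|(ratr q)^-1 * (z ord0 i)%:~R - v ord0 i|)).
exact: le_trans nq.
Qed.

Lemma exceed_noninc e : nonincreasing_seq (exceed e).
Proof.
move=> m n mn; apply/subsetPset => w [q _]; case: ifPn => // nq qw.
exists q => //; rewrite ifT //; apply: le_trans nq.
by rewrite ler_nat.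
Qed.

(* Right-continuity of the paths reduces the supremum over real times to
  rational times. *)
Lemma not_exceed e n w (t : R) : ~ exceed e n w -> n.+1%:R <= t ->
  `|t^-1 * x t w - v ord0 i| <= e.
Proof.
move=> nw nt; rewrite leNgt; apply/negP => et.
have n1 : (1 : R) <= n.+1%:R by rewrite ler1n.
have t1 := le_trans n1 nt; have t0 : 0 < t := lt_le_trans ltr01 t1.
have /near_rightP[r r0 rX] := walker_right walkerX w (ltW t0).
pose gap := `|t^-1 * x t w - v ord0 i| - e.
have gap0 : 0 < gap by rewrite subr_gt0.
pose r' := Num.min r (gap / (`|x t w| + 1)).
have x1 : 0 < `|x t w| + 1 by rewrite ltr_wpDl.
have r'0 : 0 < r' by rewrite lt_min r0 divr_gt0.
have : t < t + r' by rewrite ltrDl.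
move=> /rat_in_itvoo[q]; rewrite inE /= => /itvP qI.
have tq : t < ratr q by rewrite qI.
have : ratr q < t + r' by rewrite qI.
rewrite -ltrBlDl lt_min => /andP[qr qg]; apply: nw; exists q => //; rewrite ifT; last first.
  exact: le_trans nt (ltW tq).
have xq : x (ratr q) w = x t w by rewrite /x rX // tq -ltrBlDl.
have q0 := lt_trans t0 tq.
rewrite /far /= xq.
have dq : `|t^-1 * x t w - (ratr q)^-1 * x t w| < gap.
  rewrite -mulrBl normrM.
  have -> : t^-1 - (ratr q)^-1 = (ratr q - t) * (t^-1 * (ratr q)^-1).
    by field; rewrite !gt_eqF.
  have qt0 : 0 < ratr q - t by rewrite subr_gt0.
  have i1 : 0 <= t^-1 * (ratr q)^-1 <= 1.
    have it : 0 <= t^-1 <= 1 by rewrite invr_ge0 (ltW t0) invf_le1.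
    have iq : 0 <= (ratr q : R)^-1 <= 1.
      by rewrite invr_ge0 (ltW q0) invf_le1 // (le_trans t1) // ltW.
    by case/andP: it => ? ?; case/andP: iq => ? ?; rewrite mulr_ge0 // mulr_ile1.
  have /andP[i0 i1'] := i1.
  rewrite normrM (gtr0_norm qt0) (ger0_norm i0).
  apply: (@le_lt_trans _ _ ((ratr q - t) * (`|x t w| + 1))).
    rewrite -mulrA; apply: ler_wpM2l; first exact: ltW.
    by apply: (@le_trans _ _ `|x t w|); [exact: ler_piMl|rewrite lerDl].
  by rewrite -ltr_pdivlMr.
have := ler_normD (t^-1 * x t w - (ratr q)^-1 * x t w) ((ratr q)^-1 * x t w - v ord0 i).
rewrite subrKA; move: dq; rewrite /gap; lra.
Qed.

Lemma bad_event (e : R) : 0 < e -> exists (s : R) (A : set V),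
  [/\ 1 <= s, measurable A, (Q A <= e%:E)%E &
    forall w, ~ A w -> X 0 w = 0 /\
      forall t, s <= t -> `|t^-1 * x t w - v ord0 i| <= e].
Proof.
move=> e0.
have [N0 [mN0 QN0 sN0]] := walker_start walkerX.
have [N1 [mN1 QN1 sN1]] := speedX.
have cap0 : \bigcap_n exceed e n `<=` N1.
  move=> w cw; apply: sN1 => /= cv.
  have /cvgrPdist_lt/(_ _ e0) := cv.
  move=> [M [_ MT]].
  pose n := Num.bound `|M|.
  have [q _] := cw n I; case: ifPn => // nq; rewrite /far => /lt_geF/negP; apply.
  have Mq : M < ratr q.
    apply: lt_le_trans nq; apply: le_lt_trans (ler_norm M) _.
    by apply: lt_trans (archi_boundP (normr_ge0 M)) _; rewrite ltr_nat.
  have := MT _ Mq => /ltW; apply: le_trans.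
  rewrite [leRHS]distrC.
  have := mx_norm_entry ((ratr q)^-1 *: embed (X (ratr q) w) - v) i.
  by rewrite !mxE.
have mcap : measurable (\bigcap_n exceed e n).
  by apply: bigcapT_measurable => n; exact: measurable_exceed.
have Qcap : Q (\bigcap_n exceed e n) = 0%E.
  by apply/eqP; rewrite -measure_le0 -QN1; apply: le_measure; rewrite ?inE.
have cv := @nonincreasing_cvg_mu _ _ _ Q (exceed e) _ (measurable_exceed e) mcap
  (@exceed_noninc e).
have {}cv : Q \o exceed e @ \oo --> 0%E.
  rewrite -Qcap; apply: cv; apply: le_lt_trans (probability_le1 _ _) (ltry 1).
  exact: measurable_exceed.
have [n _ /(_ n (leqnn n)) /= Qn] :
    \forall n \near \oo, ((Q \o exceed e) n < e%:E)%E.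
  apply: (cv [set y | (y < e%:E)%E]).
  by apply: open_nbhs_nbhs; split; [exact: open_ereal_lt_ereal|rewrite /= lte_fin].
exists n.+1%:R, (exceed e n `|` N0); split.
- by rewrite ler1n.
- by apply: measurableU => //; exact: measurable_exceed.
- have QN0' : Q N0 = 0%E by exact: QN0.
  have : (Q (exceed e n `|` N0) <= Q (exceed e n) + Q N0)%E.
    by apply: measureU2 => //; exact: measurable_exceed.
  by rewrite QN0' adde0 => /le_trans -> //; exact: ltW.
move=> w /not_orP[nw nN0]; split.
  have [//|h] := pselect (X 0 w = 0); exfalso; apply: nN0; apply: sN0 => /= -[_ h'].
  exact: h.
by move=> t nt; exact: not_exceed nw nt.
Qed.

End BadEvent.

Section Clip.
Context {R : realType}.
Implicit Types (K y : R).

Definition clip K y : R := Num.max (- K) (Num.min y K).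

Lemma clip_le K y : 0 <= K -> `|clip K y| <= K.
Proof.
move=> K0; rewrite /clip ler_norml le_max lexx /= ge_max ge_min lexx orbT andbT.
by rewrite (le_trans _ K0) // oppr_le0.
Qed.

Lemma clip_id K y : `|y| <= K -> clip K y = y.
Proof. by rewrite ler_norml /clip => /andP[y1 y2]; rewrite min_l // max_r. Qed.

Lemma max_lipschitz K y y' : `|Num.max K y - Num.max K y'| <= `|y - y'|.
Proof.
have h1 := ler_norm (y - y'); have h2 := ler_norm (y' - y).
rewrite distrC in h2.
by case: (leP K y) => ?; case: (leP K y') => ?; rewrite ler_norml; lra.
Qed.

Lemma min_lipschitz K y y' : `|Num.min y K - Num.min y' K| <= `|y - y'|.
Proof.
have h1 := ler_norm (y - y'); have h2 := ler_norm (y' - y).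
rewrite distrC in h2.
by case: (leP y K) => ?; case: (leP y' K) => ?; rewrite ler_norml; lra.
Qed.

Lemma clip_lipschitz K y y' : `|clip K y - clip K y'| <= `|y - y'|.
Proof. exact: le_trans (max_lipschitz _ _ _) (min_lipschitz _ _ _). Qed.

End Clip.

Section JointGenerator.
Context {R : realType} {d : nat} {E : pmetricType R}.
Notation Om := (Omega d E).
Hypothesis rho_le1 : forall a b : E, mdist a b <= 1.
Context {dW : measure_display} {W : measurableType dW}.
Context {P : Om -> probability W R} {Y : R -> W -> Om}.
Hypothesis PY : feller_process P Y.
Hypothesis shiftY : translation_invariant P Y.
Let cY := feller_cadlag PY.

Lemma bcont_translate (x : Zd d) (u : Om -> R) : bcont u ->
  bcont (fun eta => u (translate x eta)).
Proof.
move=> bu; exact: (@bcont_comp_tau R Om unit (fun=> translate x)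
  (fun=> @translate_continuous R d E x) tt u bu).
Qed.

Lemma generator_translate (x : Zd d) (k : R) (u Lu : Om -> R) :
  bcont u -> bcont Lu -> generator P Y u Lu ->
  generator P Y (fun eta => k + u (translate x eta)) (fun eta => Lu (translate x eta)).
Proof.
move=> bu bLu [_ _ /uniform_cvg_rightP gu].
have bux := bcont_translate x bu.
split; first by case: (bcontD (bcont_cst k) bux).
  by case: (bcont_translate x bLu).
apply/uniform_cvg_rightP => e e0; have [r r0 rg] := gu _ e0.
exists r => // t tr eta; have /andP[/ltW t0 _] := tr.
rewrite (semigroupD cY) //; last exact: bcont_cst.
rewrite (semigroup_cst t k) (semigroup_translate cY shiftY) //.
by rewrite opprD addrACA subrr add0r; exact: rg.
Qed.

Context (alpha alpha0 : Om -> Zd d -> R) (c : R).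
Hypothesis alphaP : admissible alpha.
Hypothesis alpha0_cst : forall eta xi z, alpha0 eta z = alpha0 xi z.
Hypothesis alpha_c :
  (triple_norm1 (fun eta z => alpha eta z - alpha0 eta z)%R <= c%:E)%E.
Context (B : seq (Zd d)) (i : 'I_d) (e' : R).
Hypothesis uB : uniq B.
Hypothesis B0 : 0 \notin B.
Hypothesis tB : tail_bound B (fun z => fine (weighted_rate alpha z)) e'.
Context (u Lu : Om -> R) (U e m : R).
Hypothesis uU : forall eta, `|u eta| <= U.
Hypothesis u_eq : forall eta, `|Lu eta
        + \sum_(z <- B) alpha point z * (u (translate (- z) eta) - u eta)
        + partial_drift alpha B i eta - m| <= e.
Let D := fine (\esum_(z in [set: Zd d]) weighted_rate alpha z)%E.
Let ZB := \sum_(z <- B) `|embed z : 'rV[R]_d|.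
Let coord (x : Zd d) : R := (x ord0 i)%:~R.

Definition test_function (K : R) (eta : Om) (x : Zd d) : R :=
  clip K (coord x) + u (translate (- x) eta).

Definition test_generator (eta : Om) (x : Zd d) : R := Lu (translate (- x) eta).

Definition drift_error : R := e + (1 + 2 * U) * e' + 2 * U * c.

Lemma corrector_bound_ge0 : 0 <= U.
Proof. exact: le_trans (normr_ge0 _) (uU point). Qed.

Lemma rate_total_ge0 : 0 <= D.
Proof. by apply: fine_ge0; apply: esum_ge0 => z _; exact: weighted_rate_ge0. Qed.

Lemma embed_le_ZB z : z \in B -> `|coord z| <= ZB.
Proof.
move=> zB; apply: le_trans (embed_entry z i) _.
by rewrite /ZB (big_rem z) //= lerDl sumr_ge0.
Qed.

Lemma coordD x z : coord (x + z) = coord x + coord z.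
Proof. by rewrite /coord mxE rmorphD. Qed.

Lemma weight_oscillation_sum zeta :
  \sum_(z <- B) `|alpha zeta z - alpha point z| <= c.
Proof.
apply: le_trans (weighted_triple_norm_sum alphaP alpha0_cst alpha_c uB).
rewrite !big_seq; apply: ler_sum => z zB.
have z0 : z != 0 by apply: contra B0 => /eqP <-.
have := triple_norm_osc (rate_triple_norm_fin alphaP z) (bcont_rate alphaP z0).1
  rho_le1 zeta point.
move=> /le_trans; apply.
by rewrite ler_peMl ?embed_ge1 // fine_ge0 // triple_norm_ge0.
Qed.

Lemma joint_generator_bound (K : R) eta x :
  `|joint_generator alpha (test_function K) test_generator eta x - m| <=
  drift_error + (if `|coord x| + ZB <= K then 0 else 2 * D).
Proof.
set zeta := translate (- x) eta; have U0 := corrector_bound_ge0.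
pose h z := test_function K eta (x + z) - test_function K eta x.
pose hc z := clip K (coord (x + z)) - clip K (coord x).
pose hu z := u (translate (- z) zeta) - u zeta.
have hE z : h z = hc z + hu z.
  rewrite /h /hc /hu /test_function -/zeta.
  rewrite (_ : translate (- (x + z)) eta = translate (- z) zeta); first by ring.
  by rewrite /zeta translateD opprD addrC.
have hc_le z : `|hc z| <= `|coord z|.
  apply: le_trans (clip_lipschitz _ _ _) _.
  by rewrite coordD addrAC subrr add0r.
have hu_le z : `|hu z| <= 2 * U.
  apply: (le_trans (ler_normB _ _)).
  have := uU (translate (- z) zeta); have := uU zeta; lra.
have hL z : `|h z| <= (1 + 2 * U) * `|embed z : 'rV[R]_d|.
  rewrite hE; apply: (le_trans (ler_normD _ _)); rewrite mulrDl mul1r; apply: lerD.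
    exact: le_trans (hc_le z) (embed_entry z i).
  have [->|z0] := eqVneq z 0.
    by rewrite /hu oppr0 translate0 subrr normr0 !mulr_ge0.
  apply: le_trans (hu_le z) _.
  by rewrite ler_peMr ?embed_ge1 // mulr_ge0.
have U1 : 0 <= 1 + 2 * U by rewrite addr_ge0 // mulr_ge0.
have := sumZ_rates alphaP zeta U1 uB tB hL.
have := u_eq zeta.
have := weight_oscillation_sum zeta.
have a0 z := rate_ge0 alphaP zeta z.
have split_sum : \sum_(z <- B) alpha zeta z * h z =
    partial_drift alpha B i zeta +
    \sum_(z <- B) alpha zeta z * (hc z - coord z) +
    \sum_(z <- B) alpha point z * hu z +
    \sum_(z <- B) (alpha zeta z - alpha point z) * hu z.
  rewrite /partial_drift -!big_split /=; apply: eq_bigr => z _.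
  rewrite hE /coord; ring.
have clip_err : `|\sum_(z <- B) alpha zeta z * (hc z - coord z)| <=
    (if `|coord x| + ZB <= K then 0 else 2 * D).
  case: ifPn => [xK|_].
    rewrite big_seq big1 ?normr0 // => z zB.
    have zZ := embed_le_ZB zB; have ZB0 := le_trans (normr_ge0 _) zZ.
    rewrite /hc !clip_id ?coordD; first by ring.
      by apply: le_trans xK; rewrite lerDl.
    by apply: le_trans xK; apply: (le_trans (ler_normD _ _)); rewrite lerD2l.
  apply: (le_trans (ler_norm_sum _ _ _)).
  apply: (@le_trans _ _ (\sum_(z <- B) 2 * fine (weighted_rate alpha z))).
    apply: ler_sum => z _; rewrite normrM (ger0_norm (a0 z)).
    apply: (@le_trans _ _ (alpha zeta z * (2 * `|embed z : 'rV[R]_d|))).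
      apply: ler_wpM2l => //; apply: (le_trans (ler_normB _ _)).
      apply: le_trans (lerD (hc_le z) (lexx _)) _.
      by rewrite -mulr2n -[leLHS]mulr_natl ler_wpM2l // embed_entry.
    by rewrite mulrCA ler_wpM2l // mulrC rate_le.
  by rewrite -mulr_sumr ler_wpM2l // rate_sum_le.
have osc_err : `|\sum_(z <- B) (alpha zeta z - alpha point z) * hu z| <=
    (\sum_(z <- B) `|alpha zeta z - alpha point z|) * (2 * U).
  apply: (le_trans (ler_norm_sum _ _ _)); rewrite mulr_suml; apply: ler_sum => z _.
  by rewrite normrM ler_wpM2l.
move=> osc eqz szum.
have osc2 := le_trans osc_err (ler_wpM2r (mulr_ge0 (ler0n _ 2) U0) osc).
rewrite /joint_generator /test_generator -/zeta.
move: eqz szum; rewrite split_sum.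
set sz := sumZ _; set pd := partial_drift _ _ _ _.
set s1 := \sum_(z <- B) _ in clip_err *; set s2 := \sum_(z <- B) alpha point z * _.
set s3 := \sum_(z <- B) _ in osc2 *.
move: clip_err osc2; rewrite /drift_error; set cl := (if _ then _ else _).
rewrite !ler_norml; lra.
Qed.

End JointGenerator.

Section WalkerSpeed.
Context {R : realType} {d : nat} {E : pmetricType R}.
Notation Om := (Omega d E).
Hypothesis rho_le1 : forall a b : E, mdist a b <= 1.
Context {dW dV : measure_display} {W : measurableType dW} {V : measurableType dV}.
Context {P : Om -> probability W R} {Y : R -> W -> Om}.
Hypothesis PY : feller_process P Y.
Hypothesis shiftY : translation_invariant P Y.
Context (alpha alpha0 : Om -> Zd d -> R) (c : R).
Hypothesis alphaP : admissible alpha.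
Hypothesis alpha0_cst : forall eta xi z, alpha0 eta z = alpha0 xi z.
Hypothesis alpha_c :
  (triple_norm1 (fun eta z => alpha eta z - alpha0 eta z)%R <= c%:E)%E.
Context (B : seq (Zd d)) (i : 'I_d) (e' : R).
Hypothesis uB : uniq B.
Hypothesis B0 : 0 \notin B.
Hypothesis tB : tail_bound B (fun z => fine (weighted_rate alpha z)) e'.
Context (u Lu : Om -> R) (U e m : R).
Hypothesis bu : bcont u.
Hypothesis bLu : bcont Lu.
Hypothesis gu : generator P Y u Lu.
Hypothesis uU : forall eta, `|u eta| <= U.
Hypothesis u_eq : forall eta, `|Lu eta
        + \sum_(z <- B) alpha point z * (u (translate (- z) eta) - u eta)
        + partial_drift alpha B i eta - m| <= e.
Context (Q : probability V R) (eta : R -> V -> Om) (X : R -> V -> Zd d).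
Context (eta0 : Om) (v : 'rV[R]_d).
Hypothesis walkerX : walker P Y Q eta X alpha eta0.
Hypothesis speedX : {ae Q, forall w, T^-1 *: embed (X T w) @[T --> +oo] --> v}.
Local Notation leb := (@lebesgue_measure R).
Let D := fine (\esum_(z in [set: Zd d]) weighted_rate alpha z)%E.
Let ZB := \sum_(z <- B) `|embed z : 'rV[R]_d|.
Let r0 := drift_error c e' U e.
Let vi := v ord0 i.
Let F := test_function i u.
Let G := test_generator Lu.
Let x (t : R) (w : V) : R := (X t w ord0 i)%:~R.

Lemma test_joint_domain K : 0 <= K -> joint_domain P Y (F K) G.
Proof.
move=> K0; split.
  move=> y; exact: (generator_translate PY shiftY (- y) (clip K (y ord0 i)%:~R) bu bLu gu).
have [_ [L LuL]] := bLu.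
exists (Num.max (K + U) L) => zeta y; split.
  rewrite le_max; apply/orP; left; apply: (le_trans (ler_normD _ _)).
  by apply: lerD; [exact: clip_le|exact: uU].
by rewrite le_max; apply/orP; right; exact: LuL.
Qed.

Section Horizon.
Context (e1 s tau : R) (A : set V).
Hypothesis e1_ge0 : 0 <= e1.
Hypothesis e1_le1 : e1 <= 1.
Hypothesis s_ge1 : 1 <= s.
Hypothesis mA : measurable A.
Hypothesis QA : (Q A <= e1%:E)%E.
Hypothesis goodA : forall w, ~ A w -> X 0 w = 0 /\
  forall t, s <= t -> `|t^-1 * x t w - vi| <= e1.
Hypothesis s_tau : s <= tau.
Hypothesis ZB_tau : ZB <= tau.
Let K := (`|vi| + 2) * tau.

Let tau_gt0 : 0 < tau.
Proof. exact: lt_le_trans ltr01 (le_trans s_ge1 s_tau). Qed.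

Let K_ge0 : 0 <= K.
Proof. by rewrite mulr_ge0 ?addr_ge0 // ltW. Qed.

Let D0 : 0 <= D := rate_total_ge0 alpha.
Let U0 : 0 <= U := corrector_bound_ge0 uU.

Lemma fine_prob_le (C : set V) : (Q C <= e1%:E)%E -> fine (Q C) <= e1.
Proof.
move=> QC; rewrite -lee_fin fineK //.
by rewrite ge0_fin_numE ?measure_ge0 //; exact: le_lt_trans QC (ltry _).
Qed.

Lemma good_position w t : ~ A w -> s <= t -> t <= tau ->
  `|x t w - t * vi| <= t * e1 /\ `|x t w| + ZB <= K.
Proof.
move=> nA st tt; have [_ /(_ _ st) h] := goodA nA.
have t0 : 0 < t := lt_le_trans ltr01 (le_trans s_ge1 st).
have h1 : `|x t w - t * vi| <= t * e1.
  have -> : x t w - t * vi = t * (t^-1 * x t w - vi).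
    by rewrite mulrBr mulVKf ?gt_eqF.
  by rewrite normrM (gtr0_norm t0) ler_wpM2l // ltW.
split => //; have := ler_normD (x t w - t * vi) (t * vi).
rewrite subrK normrM (gtr0_norm t0) => h2.
have h3 : t * e1 <= tau by apply: le_trans tt; rewrite ler_piMr // ltW.
have h4 : t * `|vi| <= tau * `|vi| by rewrite ler_wpM2r.
rewrite /K; have := ZB_tau; lra.
Qed.

Let lebtau : fine (leb `[0, tau]%classic) = tau.
Proof. by rewrite lebesgue_measure_itv /= lte_fin tau_gt0 -EFinB /= subr0. Qed.

Let lebtau_fin : (leb `[0%R, tau]%classic < +oo)%E.
Proof. by rewrite lebesgue_measure_itv /= lte_fin tau_gt0 -EFinB ltry. Qed.

Let JI (w : V) : R := \int[leb]_(t in `[0, tau])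
  joint_generator alpha (F K) G (eta t w) (X t w).

Lemma inner_integral_good w : ~ A w -> `|JI w - m * tau| <= r0 * tau + 2 * D * s.
Proof.
move=> nA.
have := @Rintegral_step_bound R _ _ leb `[0, tau]%classic `[0, s]%classic
  (fun t => joint_generator alpha (F K) G (eta t w) (X t w)) m r0 (2 * D).
rewrite lebtau => H; apply: le_trans (H _ lebtau_fin _ _) _ => //.
  move=> t; rewrite /= in_itv /= => /andP[t1 t2].
  apply: (le_trans (joint_generator_bound rho_le1 alphaP alpha0_cst alpha_c uB B0 tB
    uU u_eq K (eta t w) (X t w))).
  rewrite -/r0 lerD2l indicE mem_setE in_itv /= t1 /=.
  have [ts|st] := leP t s; first by case: ifP; rewrite mulr1 // mulr_ge0.
  have [_ ->] := good_position nA (ltW st) t2.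
  by rewrite mulr0.
rewrite lerD2l ler_wpM2l ?mulr_ge0 //.
have s0 : 0 < s := lt_le_trans ltr01 s_ge1.
have ls : leb `[0, s]%classic = s%:E.
  by rewrite lebesgue_measure_itv /= lte_fin s0 -EFinB /= subr0.
have mI : measurable (`[0, s]%classic `&` `[0, tau]%classic : set R).
  exact: measurableI.
have lI : (leb (`[0%R, s]%classic `&` `[0%R, tau]%classic) <= s%:E)%E.
  by rewrite -ls; apply: le_measure; rewrite ?inE //; exact: subIsetl.
rewrite -lee_fin fineK // ge0_fin_numE ?measure_ge0 //.
exact: le_lt_trans lI (ltry s).
Qed.

Lemma inner_integral_bad w : `|JI w - m * tau| <= (r0 + 2 * D) * tau.
Proof.
have := @Rintegral_step_bound R _ _ leb `[0, tau]%classic set0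
  (fun t => joint_generator alpha (F K) G (eta t w) (X t w)) m (r0 + 2 * D) 0.
rewrite lebtau mul0r addr0; apply => // t _.
apply: (le_trans (joint_generator_bound rho_le1 alphaP alpha0_cst alpha_c uB B0 tB
  uU u_eq K (eta t w) (X t w))).
rewrite -/r0 mul0r addr0 lerD2l.
by case: ifP => // _; rewrite mulr_ge0.
Qed.

Lemma expected_drift :
  `|\int[Q]_w JI w - m * tau| <= r0 * tau + 2 * D * s + 2 * D * tau * e1.
Proof.
have := @Rintegral_step_bound R _ _ Q setT A JI (m * tau)
  (r0 * tau + 2 * D * s) (2 * D * tau) measurableT (probability_lty Q) mA.
have -> : fine (Q [set: V]) = 1 by exact: (congr1 fine (probability_setT Q)).
rewrite !mulr1 setIT => H; apply: le_trans (H _) _.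
  move=> w _; rewrite indicE; have [wA|nA] := boolP (w \in A).
    rewrite mulr1; apply: le_trans (inner_integral_bad w) _.
    rewrite mulrDl lerD2r lerDl !mulr_ge0 //.
    exact: le_trans ler01 s_ge1.
  rewrite mulr0 addr0; apply: inner_integral_good => wA.
  by move/negP: nA; apply; rewrite inE.
rewrite lerD2l ler_wpM2l ?fine_prob_le // !mulr_ge0 //.
exact: ltW.
Qed.

Let DF (w : V) : R := F K (eta tau w) (X tau w) - F K (eta 0 w) (X 0 w).

Lemma increment_good w : ~ A w -> `|DF w - vi * tau| <= e1 * tau + 2 * U.
Proof.
move=> nA; have [X0 _] := goodA nA.
have [xt xK] := good_position nA s_tau (lexx tau).
have xK' : `|x tau w| <= K.
  by apply: le_trans xK; rewrite lerDl sumr_ge0.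
rewrite /DF /F /test_function X0 -/(x tau w) (clip_id xK') mxE clip_id ?normr0 //.
have := uU (translate (- X tau w) (eta tau w)).
have := uU (translate (- 0) (eta 0 w)).
move: xt; rewrite !ler_norml; lra.
Qed.

Lemma increment_bad w : `|DF w - vi * tau| <= 2 * K + 2 * U + `|vi| * tau.
Proof.
apply: (le_trans (ler_normB _ _)); rewrite normrM (gtr0_norm tau_gt0) lerD2r.
rewrite /DF /F /test_function.
have := uU (translate (- X tau w) (eta tau w)).
have := uU (translate (- X 0 w) (eta 0 w)).
have := clip_le ((X tau w) ord0 i)%:~R K_ge0.
have := clip_le ((X 0 w) ord0 i)%:~R K_ge0.
rewrite !ler_norml; lra.
Qed.

Lemma expected_increment :
  `|\int[Q]_w DF w - vi * tau| <=
    e1 * tau + 2 * U + (2 * K + `|vi| * tau) * e1.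
Proof.
have := @Rintegral_step_bound R _ _ Q setT A DF (vi * tau)
  (e1 * tau + 2 * U) (2 * K + `|vi| * tau) measurableT (probability_lty Q) mA.
have -> : fine (Q [set: V]) = 1 by exact: (congr1 fine (probability_setT Q)).
have t0 := ltW tau_gt0.
rewrite !mulr1 setIT => H; apply: le_trans (H _) _.
  move=> w _; rewrite indicE; have [wA|nA] := boolP (w \in A).
    rewrite mulr1; apply: le_trans (increment_bad w) _.
    have : 0 <= e1 * tau by exact: mulr_ge0.
    lra.
  rewrite mulr0 addr0; apply: increment_good => wA.
  by move/negP: nA; apply; rewrite inE.
by rewrite lerD2l ler_wpM2l ?fine_prob_le // addr_ge0 ?mulr_ge0.
Qed.

Lemma horizon_bound : `|vi - m| * tau <=
  r0 * tau + (2 * D * s + 2 * U) +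
  (2 * D + 1 + 2 * (`|vi| + 2) + `|vi|) * e1 * tau.
Proof.
have t0 := ltW tau_gt0.
have mart : \int[Q]_w DF w = \int[Q]_w JI w.
  apply: (walker_martingale walkerX (test_joint_domain K_ge0)).
    by rewrite lexx.
  exact: generated_sigma_algebraT.
have := expected_drift; have := expected_increment; rewrite mart.
have -> : `|vi - m| * tau = `|vi * tau - m * tau|.
  by rewrite -mulrBl normrM (ger0_norm t0).
rewrite /K !ler_norml; lra.
Qed.

End Horizon.

Lemma speed_bound : `|vi - m| <= r0.
Proof.
apply/ler_addgt0Pr => g g0.
have D0 : 0 <= D := rate_total_ge0 alpha; have U0 : 0 <= U := corrector_bound_ge0 uU.
pose C1 := 2 * D + 1 + 2 * (`|vi| + 2) + `|vi|.
have C10 : 0 < C1 by rewrite /C1; have := normr_ge0 vi; lra.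
pose e1 := Num.min 1 (g / 2 / C1).
have e10 : 0 < e1 by rewrite lt_min ltr01 !divr_gt0.
have e11 : e1 <= 1 by rewrite ge_min lexx.
have e1C : C1 * e1 <= g / 2.
  by rewrite -ler_pdivlMl // mulrC ge_min lexx orbT.
have [s [A [s1 mA QA good]]] := bad_event walkerX speedX i e10.
pose C2 := 2 * D * s + 2 * U.
have C20 : 0 <= C2 by rewrite addr_ge0 // !mulr_ge0 // (le_trans ler01).
have ZB0 : 0 <= ZB by exact: sumr_ge0.
pose tau := s + ZB + C2 / (g / 2).
have q0 : 0 <= C2 / (g / 2) by rewrite divr_ge0 // ltW // divr_gt0.
have s_tau : s <= tau by rewrite /tau; lra.
have ZB_tau : ZB <= tau by rewrite /tau; lra.
have tau0 : 0 < tau := lt_le_trans ltr01 (le_trans s1 s_tau).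
have C2t : C2 <= g / 2 * tau.
  rewrite mulrC -ler_pdivrMr ?divr_gt0 // /tau; lra.
have H := horizon_bound (ltW e10) e11 s1 mA QA good s_tau ZB_tau.
rewrite -(ler_pM2r tau0); apply: le_trans H _.
rewrite -/C1 -/C2.
have : C1 * e1 * tau <= g / 2 * tau by rewrite ler_wpM2r // ltW.
lra.
Qed.

End WalkerSpeed.

Section MeanDrift.
Context {R : realType} {d : nat} {E : pmetricType R}.
Notation Om := (Omega d E).
Context (alpha : Om -> Zd d -> R) (mu : probability (borel Om) R).
Hypothesis alphaP : admissible alpha.
Context (B : seq (Zd d)) (i : 'I_d) (e : R).
Hypothesis uB : uniq B.
Hypothesis B0 : 0 \notin B.
Hypothesis tB : tail_bound B (fun z => fine (weighted_rate alpha z)) e.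

Lemma mean_partial_drift :
  `|mean_drift alpha mu ord0 i - \int[mu]_eta partial_drift alpha B i eta| <= e.
Proof.
have [cpd [K pdK]] := bcont_partial_drift alphaP B i.
have mpd := continuous_measurable_real cpd.
have ipd : mu.-integrable setT (EFin \o partial_drift alpha B i).
  by apply: (@bounded_integrable _ _ _ _ _ _ K) => //; exact: probability_lty.
have ic (c : R) : mu.-integrable setT (EFin \o (fun=> c)).
  by apply: (@bounded_integrable _ _ _ _ _ _ `|c|) => //; exact: probability_lty.
have ipdD (c : R) : mu.-integrable setT (EFin \o (fun eta => partial_drift alpha B i eta + c)).
  by have := integrableD measurableT ipd (ic c).
have Rpd (c : R) : \int[mu]_eta (partial_drift alpha B i eta + c) =
    \int[mu]_eta partial_drift alpha B i eta + c.
  by rewrite RintegralD // probability_Rintegral_cst.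
rewrite mxE ler_distl -(Rpd e) -Rpd.
apply: Rintegral_between => // eta _; rewrite -ler_distl.
rewrite (_ : sumZ _ = sumZ (fun z => alpha eta z * (z ord0 i)%:~R)); last first.
  by congr sumZ; apply/funext => z; rewrite mulrC.
rewrite /partial_drift (eq_bigr (fun z => alpha eta z * (z ord0 i)%:~R)); last first.
  by move=> z _; rewrite mulrC.
rewrite -[leRHS]mul1r; apply: (sumZ_rates alphaP) => // z.
by rewrite mul1r embed_entry.
Qed.

End MeanDrift.

Theorem theorem4p2 (R : realType) (d : nat) (d_gt0 : (0 < d)%N)
    (E : pmetricType R) (E_compact : compact [set: E])
    (rho_le1 : forall a b : E, mdist a b <= 1)
    (dW : measure_display) (W : measurableType dW)
    (P : Omega d E -> probability W R) (Y : R -> W -> Omega d E)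
    (env_feller : feller_process P Y)
    (env_shift : translation_invariant P Y)
    (dV : measure_display) (V : measurableType dV)
    (Phat : Omega d E * Omega d E -> probability V R)
    (Z : R -> V -> Omega d E * Omega d E)
    (coupling : strong_markov_coupling P Y Phat Z)
    (coupling_shift : coupling_translation_invariant Phat Z)
    (coupling_decay :
      (\int[lebesgue_measure]_(t in `[0%R, +oo[)
        ((t ^+ d)%:E *
         ereal_sup [set \int[Phat p]_w (mdist ((Z t w).1 0) ((Z t w).2 0))%:E
                   | p in [set: Omega d E * Omega d E]]) < +oo)%E)
    (muE : probability (borel (Omega d E)) R)
    (muE_ergodic : ergodic P Y muE)
    (C : R) (C_gt0 : 0 < C) :
  exists C' : R,
  forall (alpha : R -> Omega d E -> Zd d -> R) (v : R -> 'rV[R]_d),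
    (forall eps : R, 0 <= eps -> admissible (alpha eps)) ->
    (forall eta z,
      cvg ((fun eps : R => eps^-1 * (alpha eps eta z - alpha 0 eta z)) @ 0^'+)) ->
    (forall eta xi z, alpha 0 eta z = alpha 0 xi z) ->
    (forall eps : R, 0 <= eps ->
      (triple_norm1 (fun eta z => alpha eps eta z - alpha 0 eta z)%R
         <= (C * eps)%:E)%E) ->
    (forall eps : R, 0 <= eps -> asymptotic_speed P Y (alpha eps) (v eps)) ->
    forall eps : R, 0 <= eps ->
      `|v eps - mean_drift (alpha eps) muE| <= C' * eps ^+ 2.
Proof.
have decay : (decay_integral (Phat := Phat) (Z := Z) < +oo)%E.
  exact: coupling_decay.
set J := fine (decay_integral (Phat := Phat) (Z := Z)).
have J0 : 0 <= J.
  apply: fine_ge0; apply: integral_ge0 => t; rewrite /= in_itv /= andbT => t0.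
  by rewrite mule_ge0 ?coupling_distance_ge0 // lee_fin exprn_ge0.
exists (2 * (1 + J) * C ^+ 2) => alpha v adm _ alpha0 alphaC speed eps eps0.
have alphaP := adm _ eps0; set c := C * eps; have c0 : 0 <= c by rewrite mulr_ge0 // ltW.
have -> : 2 * (1 + J) * C ^+ 2 * eps ^+ 2 = 2 * (1 + J) * c ^+ 2.
  by rewrite /c; ring.
have rhs0 : 0 <= 2 * (1 + J) * c ^+ 2 by rewrite mulr_ge0 ?sqr_ge0 // mulr_ge0 // addr_ge0.
apply: mx_norm_le => // i; rewrite !mxE -/(mean_drift (alpha eps) muE).
apply/ler_addgt0Pr => g g0.
pose L := 2 + 2 * c * (1 + J) + 2 * c.
have cJ : 0 <= c * (1 + J) by rewrite mulr_ge0 // addr_ge0.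
have L0 : 0 < L by rewrite /L; lra.
pose e := g / L; have e0 : 0 < e by rewrite divr_gt0.
pose U := (c + e) * (1 + J) + e.
have eJ : 0 <= e * (1 + J) by rewrite mulr_ge0 ?addr_ge0 // ltW.
have U0 : 0 <= U by rewrite /U; lra.
have U2 : 0 < 2 + 2 * U by lra.
have e'0 : 0 < e / (2 + 2 * U) by rewrite divr_gt0.
have [B [uB B0 tB]] := rate_tail alphaP e'0.
have [u [Lu [bu bLu gu uU ueq]]] := corrector rho_le1 env_feller env_shift coupling
  coupling_shift decay muE_ergodic.1 alphaP alpha0 (alphaC _ eps0) i uB B0 e0 c0.
have [dQ [V' [Q [eta [X [wX sX]]]]]] := speed _ eps0 point.
have b1 := speed_bound rho_le1 env_feller env_shift alphaP alpha0 (alphaC _ eps0)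
  uB B0 tB bu bLu gu uU ueq wX sX.
have b2 := mean_partial_drift muE alphaP i uB tB.
have b3 := ler_normD (v eps ord0 i - \int[muE]_eta partial_drift (alpha eps) B i eta)
  (\int[muE]_eta partial_drift (alpha eps) B i eta - mean_drift (alpha eps) muE ord0 i).
rewrite subrKA in b3; rewrite distrC in b2.
have mE : mean_drift (alpha eps) muE ord0 i =
    \int[muE]_eta sumZ (fun z => (z ord0 i)%:~R * alpha eps eta z) by rewrite mxE.
rewrite -mE; apply: le_trans b3 _; apply: le_trans (lerD b1 b2) _.
have e'E : (2 + 2 * U) * (e / (2 + 2 * U)) = e by rewrite mulrC divfK ?gt_eqF.
have eL : L * e = g by rewrite /e mulrC divfK ?gt_eqF.
rewrite -eL /drift_error -/U.
have -> : e + (1 + 2 * U) * (e / (2 + 2 * U)) + 2 * U * c + e / (2 + 2 * U) =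
    e + (2 + 2 * U) * (e / (2 + 2 * U)) + 2 * U * c by ring.
rewrite e'E /U /L expr2 le_eqVlt; apply/orP; left; apply/eqP; ring.
Qed.
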